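(* Let $(\mathfrak h,(H_i,L_i)_{i\in I})$ be a linear Coxeter system with linear Coxeter group $\mathcal W$, closed fundamental chamber $\overline C$ and Tits cone $X$. Let $Y\subseteq X$ be a $\mathcal W$-invariant convex subcone containing $0$. Let the convex cone $Y\cap\overline C$ be finitely generated, and let $\Theta\subseteq I$ be special facial. (a) If $R_1,R_2\in\mathrm{Fa}(Y)_\Theta$ such that $R_1\subseteq R_2$, then every maximal chain (in $\mathrm{Fa}(Y)$) between $R_1$ and $R_2$ is contained in $\mathrm{Fa}(Y)_\Theta$. The dimensions of its successive faces differ by one. In particular, it has the length $\dim(R_2)-\dim(R_1)+1$. (b) If $R_1,R_2\in\Upsilon(\Theta)$ such that $R_1\subseteq R_2$, then $$\upsilon^*(R_1)\,\dot\cup\,\upsilon_*(R_2)=\bigcap_{R\in\Upsilon(\Theta),\ R_1\subseteq R\subseteq R_2}\upsilon(R).$$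
   Context: $\mathbb R^+_0=[0,\infty)$, $\mathbb R^+=(0,\infty)$. A convex cone is a subset of a real vector space closed under addition and under multiplication by elements of $\mathbb R^+$. $\mathrm{ri}$ denotes the relative interior of a finite-dimensional convex set. For a convex cone $K$ containing $0$, a face of $K$ is a convex cone $F\subseteq K$ with $(K\setminus F)+K\subseteq K\setminus F$; $\mathrm{Fa}(K)$ is the set of nonempty faces, ordered by inclusion. The dimension of a face is the dimension of its linear hull. The length of a finite chain is its number of elements. Linear Coxeter systems. Let $\mathfrak h$ be a finite-dimensional real vector space, $n\ge1$, $I=\{1,\dots,n\}$. For a zero-based closed ray $H\subseteq\mathfrak h$ put $H^{\ge0}=\{\lambda\in\mathfrak h^*\mid\lambda(h)\ge0\ \forall h\in H\}$, $H^{>0}=\{\lambda\mid\lambda(h)>0\ \forall h\in H\setminus\{0\}\}$, $H^{=0}=\{\lambda\mid\lambda(h)=0\ \forall h\in H\}$. A linear Coxeter system $(\mathfrak h,(H_i,L_i)_{i\in I})$ consists of zero-based closed rays $H_i\subseteq\mathfrak h$, $L_i\subseteq\mathfrak h^*$ with $L_i\setminus\{0\}\subseteq H_i^{>0}$ such that: (1) the closed fundamental chamber $\overline C=\bigcap_{i\in I}H_i^{\ge0}$ spans $\mathfrak h^*$, and $\overline C\cap H_i^{=0}$, $i\in I$, are its pairwise different faces of codimension 1; (2) with $C=\bigcap_{i\in I}H_i^{>0}$ and $\mathcal W$ (the linear Coxeter group) the group generated by the reflections $\sigma_i$ on $\mathfrak h^*$ at the hyperplane $H_i^{=0}$ along the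 line $L_i\cup(-L_i)$, one has $\sigma C\cap C=\emptyset$ for all $\sigma\in\mathcal W\setminus\{1\}$. The Tits cone is the convex cone $X=\bigcup_{\sigma\in\mathcal W}\sigma\overline C$. For each $i$ fix $h_i\in H_i$, $\alpha_i\in L_i$ with $\alpha_i(h_i)=2$ (nothing below depends on the choice), and set $A=(a_{ij})_{i,j\in I}$, $a_{ij}=\alpha_j(h_i)$. $J\subseteq I$ is facial if $\sum_{j\in J}\mathbb R^+_0h_j$ is a face of $\sum_{i\in I}\mathbb R_0^+h_i$ (empty sum $=\{0\}$). Sets $J,K\subseteq I$ are separated if $a_{jk}=0$ for all $j\in J,k\in K$; a nonempty set is connected if it is not a disjoint union of two nonempty separated subsets; connected components are the maximal nonempty connected subsets. A nonempty connected $J$ is of finite type if there is $u\in(\mathbb R^+)^J$ such that all entries of $(a_{ij})_{i,j\in J}\,u$ are positive. $J^\infty$ is the union of the components of $J$ not of finite type. $J$ is special if $J^\infty=J$ (so $\emptyset$ is special). Special facial means special and facial. $\Upsilon=\{R\in\mathrm{Fa}(Y)\mid\mathrm{ri}(R)\cap\overline C\ne\emptyset\}$. For $R\in\Upsilon$: $\upsilon(R)=\{i\in I\mid\sigma_iR=R\}$, $\upsilon_*(R)=\{i\in I\mid\sigma_i\text{ fixes }R\text{ pointwise}\}$, $\upsilon^*(R)=\upsilon(R)\setminus\upsilon_*(R)$. For $\Theta$ special facial, $\Upsilon(\Theta)=\{R\in\Upsilon\mid\upsilon_*(R)^\infty=\Theta\}$ and $\mathrm{Fa}(Y)_\Theta=\mathcal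 W\,\Upsilon(\Theta)=\{\sigma R\mid\sigma\in\mathcal W,\ R\in\Upsilon(\Theta)\}$ (possibly empty). *)

(* Defs.v *)
From HB Require Import structures.
From mathcomp Require Import all_boot all_order all_algebra.
From mathcomp Require Import all_classical all_reals.

Set Implicit Arguments.
Unset Strict Implicit.
Unset Printing Implicit Defensive.

Import Order.TTheory GRing.Theory Num.Theory.

Local Open Scope classical_set_scope.
Local Open Scope ring_scope.

Definition convex_cone (R : realType) (V : vectType R) (K : set V) : Prop :=
  (forall x y, K x -> K y -> K (x + y)) /\
  (forall (c : R) x, 0 < c -> K x -> K (c *: x)).

(* Nonnegative combinations; the empty sum gives [{0}]. *)
Definition pos_cone (R : realType) (V : vectType R) (n : nat)
    (v : 'I_n -> V) (J : {set 'I_n}) : set V :=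
  [set x | exists c : 'I_n -> R,
     (forall i, 0 <= c i) /\ x = \sum_(i in J) c i *: v i].

Definition finitely_generated (R : realType) (V : vectType R) (K : set V) :
    Prop :=
  exists (n : nat) (v : 'I_n -> V), K = pos_cone v finset.setT.

Definition is_face (R : realType) (V : vectType R) (K F : set V) : Prop :=
  [/\ convex_cone F, F `<=` K &
      forall x y, (K `\` F) x -> K y -> (K `\` F) (x + y)].

Definition Fa (R : realType) (V : vectType R) (K : set V) : set (set V) :=
  [set F | is_face K F /\ F !=set0].

(* The smallest linear subspace containing [S]; it always exists, so the default
   value of [xget] is irrelevant. *)
Definition lin_hull (R : realType) (V : vectType R) (S : set V) : {vspace V} :=
  xget 0%VS [set U : {vspace V} |
    (forall x, S x -> x \in U) /\
    (forall U' : {vspace V}, (forall x, S x -> x \in U') -> (U <= U')%VS)].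

Definition cone_dim (R : realType) (V : vectType R) (S : set V) : nat :=
  \dim (lin_hull S).

Definition aff_hull (R : realType) (V : vectType R) (S : set V) : set V :=
  [set x | exists (k : nat) (v : 'I_k -> V) (c : 'I_k -> R),
     [/\ forall i, S (v i), \sum_i c i = 1 & x = \sum_i c i *: v i]].

(* Interior of [S] relative to its affine hull, for the usual topology of a
   finite-dimensional real vector space: open balls are taken for the sup norm
   of the coordinates in the canonical basis [vbasis fullv]. *)
Definition relint (R : realType) (V : vectType R) (S : set V) : set V :=
  [set x | S x /\ exists2 e : R, 0 < e &
     forall y, aff_hull S y ->
       (forall i, `|coord (vbasis (fullv : {vspace V})) i (y - x)| < e) -> S y].

Definition is_ray (R : realType) (V : vectType R) (S : set V) : Prop :=
  exists2 v : V, v != 0 & S = [set x | exists2 t : R, 0 <= t & x = t *: v].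

Definition ge0_part (R : realType) (hh : vectType R) (H : set hh) :
    set 'Hom(hh, R^o) :=
  [set l | forall x, H x -> 0 <= (l x : R)].

Definition gt0_part (R : realType) (hh : vectType R) (H : set hh) :
    set 'Hom(hh, R^o) :=
  [set l | forall x, H x -> x != 0 -> 0 < (l x : R)].

Definition eq0_part (R : realType) (hh : vectType R) (H : set hh) :
    set 'Hom(hh, R^o) :=
  [set l | forall x, H x -> l x = 0].

Definition is_reflection (R : realType) (V : vectType R) (P D : set V)
    (s : 'End(V)) : Prop :=
  (forall v, P v -> s v = v) /\ (forall v, D v -> s v = - v).

(* When [P] is a hyperplane and [D] a line not contained in [P], there is exactly
   one endomorphism satisfying [is_reflection P D], so the default value of
   [xget] is irrelevant. *)
Definition reflection (R : realType) (V : vectType R) (P D : set V) : 'End(V) :=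
  xget \1%VF [set s | is_reflection P D s].

Definition is_group (R : realType) (V : vectType R) (G : set 'End(V)) : Prop :=
  [/\ G \1%VF,
      forall s t, G s -> G t -> G (s \o t)%VF &
      forall s, G s -> G (s^-1)%VF].

Definition group_generated (R : realType) (V : vectType R) (S : set 'End(V)) :
    set 'End(V) :=
  smallest (@is_group R V) S.

Definition chamber (R : realType) (hh : vectType R) (n : nat)
    (H : 'I_n -> set hh) : set 'Hom(hh, R^o) :=
  [set l | forall i, gt0_part (H i) l].

Definition closed_chamber (R : realType) (hh : vectType R) (n : nat)
    (H : 'I_n -> set hh) : set 'Hom(hh, R^o) :=
  [set l | forall i, ge0_part (H i) l].

Definition sigma (R : realType) (hh : vectType R) (n : nat)
    (H : 'I_n -> set hh) (L : 'I_n -> set 'Hom(hh, R^o)) (i : 'I_n) :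
    'End('Hom(hh, R^o)) :=
  reflection (eq0_part (H i)) (L i `|` [set - l | l in L i]).

Definition coxeter_group (R : realType) (hh : vectType R) (n : nat)
    (H : 'I_n -> set hh) (L : 'I_n -> set 'Hom(hh, R^o)) :
    set 'End('Hom(hh, R^o)) :=
  group_generated (range (sigma H L)).

(* [lcs_walls_inj] and [lcs_walls] together: the sets
   [closed_chamber H `&` eq0_part (H i)] are pairwise different and are exactly the
   faces of codimension 1 of the closed chamber. *)
Record linear_coxeter_system (R : realType) (hh : vectType R) (n : nat)
    (H : 'I_n -> set hh) (L : 'I_n -> set 'Hom(hh, R^o)) : Prop := {
  lcs_rayH : forall i, is_ray (H i);
  lcs_rayL : forall i, is_ray (L i);
  lcs_pos : forall i, L i `\ 0 `<=` gt0_part (H i);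
  lcs_span : lin_hull (closed_chamber H) = fullv;
  lcs_walls_inj : injective (fun i => closed_chamber H `&` eq0_part (H i));
  lcs_walls : forall F : set 'Hom(hh, R^o),
    (Fa (closed_chamber H) F /\
     (cone_dim F + 1 = \dim (fullv : {vspace 'Hom(hh, R^o)}))%N) <->
    (exists i, F = closed_chamber H `&` eq0_part (H i));
  lcs_chamber : forall s, coxeter_group H L s -> s <> \1%VF ->
    [set s l | l in chamber H] `&` chamber H = set0
}.

Definition tits_cone (R : realType) (hh : vectType R) (n : nat)
    (H : 'I_n -> set hh) (L : 'I_n -> set 'Hom(hh, R^o)) :
    set 'Hom(hh, R^o) :=
  \bigcup_(s in coxeter_group H L) [set s l | l in closed_chamber H].

Definition coxA (R : realType) (hh : vectType R) (n : nat)
    (h : 'I_n -> hh) (alpha : 'I_n -> 'Hom(hh, R^o)) : 'M[R]_n :=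
  \matrix_(i, j) (alpha j (h i) : R).

Definition facial (R : realType) (hh : vectType R) (n : nat)
    (h : 'I_n -> hh) (J : {set 'I_n}) : Prop :=
  is_face (pos_cone h finset.setT) (pos_cone h J).

Definition separated (R : realType) (n : nat) (A : 'M[R]_n)
    (J K : {set 'I_n}) : bool :=
  [forall j in J, forall k in K, A j k == 0].

Definition connected (R : realType) (n : nat) (A : 'M[R]_n)
    (J : {set 'I_n}) : bool :=
  (J != finset.set0) &&
  ~~ [exists J1 : {set 'I_n}, exists J2 : {set 'I_n},
       [&& J1 != finset.set0, J2 != finset.set0, [disjoint J1 & J2],
           J1 :|: J2 == J & separated A J1 J2]].

(* [K] is a connected component of [J]. *)
Definition component (R : realType) (n : nat) (A : 'M[R]_n)
    (J K : {set 'I_n}) : bool :=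
  maxset (fun K' : {set 'I_n} => (K' \subset J) && connected A K') K.

Definition finite_type (R : realType) (n : nat) (A : 'M[R]_n)
    (J : {set 'I_n}) : Prop :=
  exists u : 'I_n -> R, (forall j, j \in J -> 0 < u j) /\
    (forall i, i \in J -> 0 < \sum_(j in J) A i j * u j).

(* [J^\infty]: the union of the components of [J] not of finite type. *)
Definition inf_part (R : realType) (n : nat) (A : 'M[R]_n)
    (J : {set 'I_n}) : {set 'I_n} :=
  (\bigcup_(K : {set 'I_n} | component A J K && ~~ `[< finite_type A K >]) K)%SET.

Definition special (R : realType) (n : nat) (A : 'M[R]_n)
    (J : {set 'I_n}) : Prop := inf_part A J = J.

Definition Upsilon (R : realType) (hh : vectType R) (n : nat)
    (H : 'I_n -> set hh) (Y : set 'Hom(hh, R^o)) :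
    set (set 'Hom(hh, R^o)) :=
  [set F | Fa Y F /\ relint F `&` closed_chamber H !=set0].

Definition upsilon (R : realType) (hh : vectType R) (n : nat)
    (H : 'I_n -> set hh) (L : 'I_n -> set 'Hom(hh, R^o))
    (F : set 'Hom(hh, R^o)) : {set 'I_n} :=
  finset (fun i => `[< [set sigma H L i l | l in F] = F >]).

(* [upsilon], [upsilon_low] and [upsilon_up] are $\upsilon$, $\upsilon_*$ and
   $\upsilon^*$; [Upsilon_at] and [Fa_at] are $\Upsilon(\Theta)$ and
   $\mathrm{Fa}(Y)_\Theta$. *)
Definition upsilon_low (R : realType) (hh : vectType R) (n : nat)
    (H : 'I_n -> set hh) (L : 'I_n -> set 'Hom(hh, R^o))
    (F : set 'Hom(hh, R^o)) : {set 'I_n} :=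
  finset (fun i => `[< forall l, F l -> sigma H L i l = l >]).

Definition upsilon_up (R : realType) (hh : vectType R) (n : nat)
    (H : 'I_n -> set hh) (L : 'I_n -> set 'Hom(hh, R^o))
    (F : set 'Hom(hh, R^o)) : {set 'I_n} :=
  upsilon H L F :\: upsilon_low H L F.

Definition Upsilon_at (R : realType) (hh : vectType R) (n : nat)
    (H : 'I_n -> set hh) (L : 'I_n -> set 'Hom(hh, R^o)) (A : 'M[R]_n)
    (Y : set 'Hom(hh, R^o)) (Theta : {set 'I_n}) :
    set (set 'Hom(hh, R^o)) :=
  [set F | Upsilon H Y F /\ inf_part A (upsilon_low H L F) = Theta].

Definition Fa_at (R : realType) (hh : vectType R) (n : nat)
    (H : 'I_n -> set hh) (L : 'I_n -> set 'Hom(hh, R^o)) (A : 'M[R]_n)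
    (Y : set 'Hom(hh, R^o)) (Theta : {set 'I_n}) :
    set (set 'Hom(hh, R^o)) :=
  [set G | exists s F, [/\ coxeter_group H L s, Upsilon_at H L A Y Theta F &
                           G = [set s l | l in F]]].

(* The order on [set (set T)] used for chains is inclusion; chains are not assumed
   finite. *)
Definition chain_between (T : Type) (P : set (set T)) (F1 F2 : set T)
    (D : set (set T)) : Prop :=
  (forall F, D F -> [/\ P F, F1 `<=` F & F `<=` F2]) /\
  total_on D (fun F G => F `<=` G).

Definition maximal_chain_between (T : Type) (P : set (set T)) (F1 F2 : set T)
    (D : set (set T)) : Prop :=
  chain_between P F1 F2 D /\
  (forall D', chain_between P F1 F2 D' -> D `<=` D' -> D' = D).

Definition successive (T : Type) (D : set (set T)) (F G : set T) : Prop :=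
  [/\ D F, D G, F `<` G & forall E, D E -> ~ (F `<` E /\ E `<` G)].

(* Main.v *)
Require Import Defs.
From HB Require Import structures.
From mathcomp Require Import all_boot all_order all_algebra.
From mathcomp Require Import all_classical all_reals.
From mathcomp Require Import perm zify ring lra.

Set Implicit Arguments.
Unset Strict Implicit.
Unset Printing Implicit Defensive.

Import Order.TTheory GRing.Theory Num.Theory.

Local Open Scope classical_set_scope.
Local Open Scope ring_scope.

(* Since the chamber translates are disjoint, a root never vanishes on one of them;
   this gives the exchange property and makes the chamber a fundamental domain.
   If [lam] in the chamber is a sum of two points of the Tits cone, Vinberg's
   trichotomy shows that the infinite part of the stabilizer of [lam] fixes both
   summands; hence the type of a face is read off at any chamber point of its
   relative interior, and types decrease along inclusions.  The finite part of such
   a stabilizer generates a finite group (a root that stays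
   positive along all short words would be contracted to zero by products of
   reflections, whose determinants are [1] or [-1]).  So if
   [R1] and [R2] have the same type then, around a point of the relative interior
   of [R1], the face [R2] is a union of finitely many translates of the finitely
   generated cone [Y] cut by the chamber; its quotient by the span of [R1] has an
   extreme ray, which yields a face of dimension [dim R1 + 1] between them. *)

(** The matrix [A] need not be symmetrizable, so no invariant scalar product is at hand to prove
    that finite parts generate finite groups; determinants and signs of roots on the chamber take
    its place. Reduced expressions are avoided too: group elements are words, and the sign of a root
    tells when a word can be shortened. The obstacle in (a) is that infinitely many translates of
    the chamber may meet [R2], so [R2] itself need not be finitely generated. Equality of types is
    used exactly here: the infinite part of the stabilizer of a point of the relative interior of
    [R1] then fixes [R2] pointwise, and only the finite part moves it. The inclusion in (b) that is
    not formal climbs from [R1] to [R2] by the one-dimensional steps built for (a). *)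

(** * Words in the reflections *)

Section Words.
Variables (R : realType) (V : vectType R) (n : nat).
Variables (eta : 'I_n -> {scalar V}) (alpha : 'I_n -> V).

Definition refl i (x : V) : V := x - eta i x *: alpha i.

(** Words replace group elements: the inverse of [act w] is [act (rev w)], and inductions run on the
    length of the word, reduced or not. *)
Definition act (w : seq 'I_n) (x : V) : V := foldr refl x w.

Lemma refl_is_linear i : linear (refl i).
Proof.
move=> a x y; rewrite /refl linearD /= scalarZ.
by rewrite scalerDl -scalerA scalerBr opprD addrACA.
Qed.

HB.instance Definition _ i := GRing.isLinear.Build R V V *:%R (refl i)
  (refl_is_linear i).

Lemma act_is_linear w : linear (act w).
Proof. by elim: w => [//|i w IH] a x y /=; rewrite IH linearP. Qed.

HB.instance Definition _ w := GRing.isLinear.Build R V V *:%R (act w)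
  (act_is_linear w).

Lemma act_cat u w x : act (u ++ w) x = act u (act w x).
Proof. exact: foldr_cat. Qed.

Lemma act_cons i w x : act (i :: w) x = refl i (act w x).
Proof. by []. Qed.

Lemma act_rcons u i x : act (rcons u i) x = act u (refl i x).
Proof. by rewrite -cats1 act_cat. Qed.

Lemma reflE i x : refl i x = x - eta i x *: alpha i.
Proof. by []. Qed.

Lemma eta_refl i j x : eta i (refl j x) = eta i x - eta j x * eta i (alpha j).
Proof. by rewrite /refl linearB /= scalarZ. Qed.

Lemma refl_fix i x : eta i x = 0 -> refl i x = x.
Proof. by rewrite /refl => ->; rewrite scale0r subr0. Qed.

Definition cartan : 'M[R]_n := \matrix_(i, j) eta i (alpha j).

Definition dom (J : {set 'I_n}) (x : V) := forall j, j \in J -> 0 <= eta j x.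

Lemma eta_sum i (J : {set 'I_n}) (c : 'I_n -> R) :
  eta i (\sum_(j in J) c j *: alpha j) = \sum_(j in J) cartan i j * c j.
Proof. by rewrite linear_sum; apply: eq_bigr => j _; rewrite linearZ_LR mxE mulrC. Qed.

Hypothesis eta_alpha : forall i, eta i (alpha i) = 2.

Lemma reflK i : involutive (refl i).
Proof.
move=> x; rewrite {1}/refl eta_refl eta_alpha /refl -addrA -opprD -scalerDl.
rewrite [X in X *: _](_ : _ = 0) ?scale0r ?subr0 //; ring.
Qed.

Lemma act_revK w : cancel (act w) (act (rev w)).
Proof.
elim: w => [//|i w IH] x.
by rewrite rev_cons act_rcons act_cons reflK.
Qed.

Lemma act_Krev w : cancel (act (rev w)) (act w).
Proof. by move=> x; rewrite -{1}(revK w) act_revK. Qed.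

Lemma refl_fixE i x : refl i x = x -> eta i x = 0.
Proof.
move=> /(congr1 (eta i)); rewrite eta_refl eta_alpha => ?; lra.
Qed.

End Words.

(** * Components and types of Cartan matrices *)

Section Components.
Variables (R : realType) (n : nat) (A : 'M[R]_n).
Implicit Types (i j k : 'I_n) (J K : {set 'I_n}).
Hypothesis A0_sym : forall i j, A i j = 0 -> A j i = 0.

(** The form in which connectedness is used: whatever holds at some index and passes along nonzero
    entries spreads over [K]. *)
Lemma connectedP K : reflect
  (K != finset.set0 /\ forall J1, J1 \subset K -> J1 != finset.set0 -> J1 != K ->
     exists i j, [/\ i \in J1, j \in K :\: J1 & A i j != 0])
  (connected A K).
Proof.
apply: (iffP andP) => -[K0 H]; split => //.
  move=> J1 J1K J10 J1n; apply: contrapT => no; case/negP: H.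
  apply/existsP; exists J1; apply/existsP; exists (K :\: J1).
  apply/and5P; split => //.
  - by rewrite finset.setD_eq0; apply: contra J1n => KJ; rewrite finset.eqEsubset J1K.
  - by rewrite -finset.setI_eq0 finset.setIDA finset.setIC -finset.setIDA finset.setDv finset.setI0.
  - apply/eqP/finset.setP => k; rewrite !inE.
    by case: (boolP (k \in J1)) => [/(fintype.subsetP J1K) ->|].
  - apply/forall_inP => i iJ; apply/forall_inP => j jK; apply: contrapT => /negP Aij.
    by apply: no; exists i, j.
apply/negP => /existsP[J1 /existsP[J2 /and5P[J10 J20 dJ /eqP JK sep]]].
have J1K : J1 \subset K by rewrite -JK finset.subsetUl.
have [//|//||i [j [iJ]]] := H J1.
  apply: contra J20 => /eqP E; have J2K : J2 \subset J1 by rewrite E -JK finset.subsetUr.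
  by move: dJ; rewrite -finset.setI_eq0 (finset.setIidPr J2K).
rewrite -JK inE => /andP[/negbTE jn]; rewrite inE jn /= => jJ.
by move/forall_inP: sep => /(_ i iJ)/forall_inP/(_ j jJ) ->.
Qed.

Lemma connected1 i : connected A [set i].
Proof.
apply/connectedP; split; first by apply/finset.set0Pn; exists i; rewrite inE.
move=> J1 J1i J10 /negP[]; rewrite finset.eqEsubset J1i finset.sub1set.
have /finset.set0Pn[j jJ] := J10.
by have := fintype.subsetP J1i j jJ; rewrite inE => /eqP <-.
Qed.

Lemma connectedU J K i j : connected A J -> connected A K -> i \in J -> j \in K ->
  (i == j) || (A i j != 0) -> connected A (J :|: K).
Proof.
move=> /connectedP[J0 cJ] /connectedP[K0 cK] iJ jK ij; apply/connectedP; split.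
  by apply/finset.set0Pn; exists i; rewrite inE iJ.
move=> S SU S0 Sn.
(* This settles every case except that [S] contains one of the two sets and misses the other; there
   the link between [i] and [j] leads out of [S]. *)
have step (T : {set 'I_n}) : (forall J1, J1 \subset T -> J1 != finset.set0 -> J1 != T ->
    exists i j, [/\ i \in J1, j \in T :\: J1 & A i j != 0]) -> T \subset J :|: K ->
    S :&: T != finset.set0 -> ~~ (T \subset S) ->
    exists i j, [/\ i \in S, j \in (J :|: K) :\: S & A i j != 0].
  move=> cT TU ST0 TS; have [|//||k [l [kS lT kl]]] := cT (S :&: T).
  - exact: finset.subsetIr.
  - by apply: contra TS => /eqP <-; exact: finset.subsetIl.
  - exists k, l; split => //; first by move: kS; rewrite inE => /andP[].
    move: lT; rewrite !finset.in_setD !finset.in_setI.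
    move=> /andP[lS lT]; rewrite lT andbT in lS; rewrite lS /=.
    exact: (fintype.subsetP TU).
have [SJ|SJ] := eqVneq (S :&: J) finset.set0; last first.
  have [JS|/(step _ cJ (finset.subsetUl _ _) SJ)//] := boolP (J \subset S).
  have [SK|SK] := eqVneq (S :&: K) finset.set0.
    have iS := fintype.subsetP JS i iJ; have jS : j \notin S.
      by apply/negP => jS; have := finset.in_set0 j; rewrite -SK inE jS jK.
    exists i, j; split => //; first by rewrite !inE jS jK orbT.
    by case/orP: ij => // /eqP E; rewrite -E iS in jS.
  apply: (step _ cK (finset.subsetUr _ _) SK).
  by apply: contra Sn => KS; rewrite finset.eqEsubset SU finset.subUset JS.
have SK : S :&: K = S.
  apply/finset.setIidPl/fintype.subsetP => k kS; have := fintype.subsetP SU k kS.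
  rewrite inE => /orP[kJ|//].
  by have := finset.in_set0 k; rewrite -SJ inE kS kJ.
have [KS|KS] := boolP (K \subset S); last by apply: (step _ cK (finset.subsetUr _ _)); rewrite // SK.
have jS := fintype.subsetP KS j jK; have iS : i \notin S.
  by apply/negP => iS; have := finset.in_set0 i; rewrite -SJ inE iS iJ.
exists j, i; split => //; first by rewrite !inE iS iJ.
case/orP: ij => [/eqP E|]; first by rewrite E jS in iS.
by apply: contra => /eqP /A0_sym ->.
Qed.

Lemma componentW J K : component A J K -> K \subset J /\ connected A K.
Proof. by move=> /maxsetP[/andP[]]. Qed.

Lemma component_exists J K : K \subset J -> connected A K ->
  exists2 K', component A J K' & K \subset K'.
Proof.
move=> KJ cK; have [|K' mK' KK'] := @maxset_exists _ (fun K' => (K' \subset J) && connected A K') K.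
  by rewrite KJ.
by exists K'.
Qed.

Lemma component_max J K K' : component A J K -> K' \subset J -> connected A K' ->
  K \subset K' -> K' = K.
Proof. by move=> /maxsetP[_ H] KJ cK; apply: H; rewrite KJ. Qed.

Lemma component_sep J K i j : component A J K -> i \in K -> j \in J :\: K ->
  A i j = 0 /\ A j i = 0.
Proof.
move=> cK iK; rewrite inE => /andP[jK jJ].
have [KJ cnK] := componentW cK.
suff Aij : A i j = 0 by split => //; exact: A0_sym.
apply/eqP; apply: contraNT jK => Aij.
have cU : connected A (K :|: [set j]).
  by apply: (connectedU cnK (connected1 j) iK (set11 j)); rewrite Aij orbT.
rewrite -(component_max cK _ cU) ?finset.subsetUl ?inE ?eqxx ?orbT //.
by rewrite finset.subUset KJ finset.sub1set.
Qed.

Lemma component_in J i : i \in J -> exists2 K, component A J K & i \in K.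
Proof.
move=> iJ; have [|K cK iK] := @component_exists J [set i] _ (connected1 i).
  by rewrite finset.sub1set.
by exists K => //; rewrite -finset.sub1set.
Qed.

Lemma in_inf_partP J i : reflect
  (exists K, [/\ component A J K, ~ finite_type A K & i \in K]) (i \in inf_part A J).
Proof.
apply: (iffP finset.bigcupP) => [[K /andP[cK /asboolP fK] iK]|[K [cK fK iK]]]; exists K => //.
by rewrite cK; apply/asboolP.
Qed.

Lemma inf_part_sub J : inf_part A J \subset J.
Proof.
by apply/fintype.subsetP => i /in_inf_partP[K [/componentW[/fintype.subsetP KJ _] _ /KJ]].
Qed.

Hypothesis A_diag : forall i, A i i = 2.
Hypothesis A_le0 : forall i j, i != j -> A i j <= 0.

(** The same [u] works: the terms dropped from a row are off-diagonal, hence nonpositive. *)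
Lemma finite_typeS K K' : K' \subset K -> finite_type A K -> finite_type A K'.
Proof.
move=> /fintype.subsetP KK [u [u0 Au]]; exists u; split => [j /KK/u0//|i iK'].
have iK := KK _ iK'; apply: lt_le_trans (Au i iK) _.
rewrite (bigID (mem K')) /= -[leRHS]addr0 lerD //.
  rewrite le_eqVlt; apply/orP; left; apply/eqP/eq_bigl => j.
  by rewrite andb_idl // => /KK.
apply: sumr_le0 => j /andP[jK jK']; apply: mulr_le0_ge0; last exact/ltW/u0.
by apply: A_le0; apply: contraNneq jK' => <-.
Qed.

(** A component of [J] lies in a component of [K], and by [finite_typeS] the larger one is not of
    finite type if the smaller is not. *)
Lemma inf_partS J K : J \subset K -> inf_part A J \subset inf_part A K.
Proof.
move=> JK; apply/fintype.subsetP => i /in_inf_partP[J1 [cJ1 fJ1 iJ1]].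
have [J1J cnJ1] := componentW cJ1.
have [K1 cK1 JK1] := component_exists (fintype.subset_trans J1J JK) cnJ1.
apply/in_inf_partP; exists K1; split => //; last exact: (fintype.subsetP JK1).
by move=> /(finite_typeS JK1).
Qed.

Lemma inf_partK J : inf_part A (inf_part A J) = inf_part A J.
Proof.
apply/eqP; rewrite finset.eqEsubset inf_part_sub; apply/fintype.subsetP => i.
move=> /in_inf_partP[K [cK fK iK]]; apply/in_inf_partP; exists K; split => //.
have [KJ cnK] := componentW cK.
have KI : K \subset inf_part A J.
  by apply/fintype.subsetP => j jK; apply/in_inf_partP; exists K.
apply/maxsetP; rewrite KI cnK; split => // K' /andP[K'I cK'] KK'.
exact: component_max cK (fintype.subset_trans K'I (inf_part_sub J)) cK' KK'.
Qed.

Lemma sum_component J K (c : 'I_n -> R) i : component A J K -> i \in K ->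
  \sum_(j in J) A i j * c j = \sum_(j in K) A i j * c j.
Proof.
move=> cK iK; have [/fintype.subsetP KJ _] := componentW cK.
rewrite (bigID (mem K)) /= [X in _ + X]big1 ?addr0.
  by apply: eq_bigl => j; rewrite andb_idl // => /KJ.
move=> j /andP[jJ jK]; have [|-> _] := component_sep (j := j) cK iK; first by rewrite inE jK.
by rewrite mul0r.
Qed.

(* A positive vector with nonnegative image gives, by lowering slightly the
   entries where the image is positive, one whose image is positive everywhere. *)
Lemma finite_type_pos K (c : 'I_n -> R) : connected A K ->
  (forall j, j \in K -> 0 < c j) ->
  (forall i, i \in K -> 0 <= \sum_(j in K) A i j * c j) ->
  (exists2 i, i \in K & 0 < \sum_(j in K) A i j * c j) -> finite_type A K.
Proof.
move=> /connectedP[_ cnK].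
pose S (c : 'I_n -> R) := [set i in K | 0 < \sum_(j in K) A i j * c j].
have [m] := ubnP (#|K :\: S c|); elim: m c => // m IH c sm c0 Ac0 [i0 i0K i0c].
have SK : S c \subset K by apply/fintype.subsetP => i; rewrite inE => /andP[].
have [SE|SE] := eqVneq (S c) K.
  by exists c; split => // i; rewrite -{1}SE inE => /andP[].
have [//||//|i [j [iS jS Aij]]] := cnK (S c).
  by apply/finset.set0Pn; exists i0; rewrite inE i0K.
have iK := fintype.subsetP SK i iS.
move: jS; rewrite inE => /andP[jS jK].
have ij : i != j by apply: contraNneq jS => <-.
have Aji : A j i < 0.
  rewrite lt_neqAle A_le0 1?eq_sym // andbT eq_sym.
  by apply: contra Aij => /eqP /A0_sym ->.
move: (iS); rewrite inE iK /= => iS0.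
(* The first bound keeps entry [i] positive; the second keeps row [i] positive, which loses [2 * e]
   through its diagonal entry. *)
pose e := Num.min (c i / 2) ((\sum_(j in K) A i j * c j) / 4).
have e0 : 0 < e by rewrite lt_min !divr_gt0 // c0.
pose c' k := if k == i then c i - e else c k.
have Ac' k : k \in K -> \sum_(l in K) A k l * c' l = \sum_(l in K) A k l * c l - A k i * e.
  move=> kK; rewrite (bigD1 i) //= [in RHS](bigD1 i) //= /c' eqxx.
  rewrite (eq_bigr (fun l => A k l * c l)); first ring.
  by move=> l /andP[_ /negbTE ->].
have S' k : k \in S c -> k \in S c'.
  rewrite !inE => /andP[kK k0]; rewrite kK Ac' //=.
  have [->|ki] := eqVneq k i; last first.
    by have := A_le0 ki; rewrite subr_gt0 => Aki; apply: le_lt_trans k0; rewrite mulr_le0_ge0 // ltW.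
  rewrite A_diag; have : e <= (\sum_(j in K) A i j * c j) / 4 by rewrite ge_min lexx orbT.
  by move=> ?; lra.
apply: (IH c').
- apply: (@leq_trans #|K :\: S c|); last by rewrite -ltnS.
  apply: proper_card.
  apply/properP; split.
    by apply/fintype.subsetP => k; rewrite !finset.in_setD => /andP[kS ->]; rewrite andbT; apply: contra kS; exact: S'.
  exists j; first by rewrite finset.in_setD jS jK.
  rewrite finset.in_setD jK andbT negbK inE jK Ac' //=.
  by have := Ac0 j jK; nra.
- move=> k kK; rewrite /c'; case: eqVneq => [_|_]; last exact: c0.
  have : e <= c i / 2 by rewrite ge_min lexx.
  by have := c0 i iK => ? ?; lra.
- move=> k kK; have [kS|kS] := boolP (k \in S c).
    by have := S' k kS; rewrite inE => /andP[_ /ltW].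
  have ki : k != i by apply: contraNneq kS => ->.
  rewrite Ac' //; have := A_le0 ki; have := Ac0 k kK; nra.
- by exists i => //; have := S' i iS; rewrite inE => /andP[].
Qed.

(** A positive row sum would give finite type by [finite_type_pos], once [c] has no zero in [K]. It
    has none: by connectedness some zero entry would have a nonzero neighbour, and its row sum would
    be negative. *)
Lemma not_finite_type_ge0 K (c : 'I_n -> R) : connected A K -> ~ finite_type A K ->
  (forall j, j \in K -> 0 <= c j) ->
  (forall i, i \in K -> 0 <= \sum_(j in K) A i j * c j) ->
  forall i, i \in K -> \sum_(j in K) A i j * c j = 0.
Proof.
move=> cK fK c0 Ac0 i iK; apply: contrapT => Ai.
have {}Ai : 0 < \sum_(j in K) A i j * c j by rewrite lt_neqAle Ac0 // andbT eq_sym; apply/eqP.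
apply: fK; apply: (finite_type_pos cK _ Ac0); last by exists i.
pose Z := [set j in K | c j == 0].
have ZK : Z \subset K by apply/fintype.subsetP => j; rewrite inE => /andP[].
have Zn : Z != K.
  apply/eqP => E; move: Ai; rewrite big1 ?ltxx // => j; rewrite -E inE => /andP[_ /eqP ->].
  by rewrite mulr0.
suff Z0 : Z = finset.set0.
  move=> j jK; rewrite lt_neqAle c0 // andbT eq_sym; apply/negP => cj.
  by have := finset.in_set0 j; rewrite -Z0 inE jK cj.
apply/eqP; apply: contraT => Z0.
have /connectedP[_ cn] := cK; have [k [j [kZ jZ]]] := cn Z ZK Z0 Zn.
have kK := fintype.subsetP ZK k kZ; move: (kZ); rewrite inE kK /= => /eqP ck.
move: (jZ); rewrite inE => /andP[jZ' jK]; rewrite inE jK /= in jZ'.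
have := Ac0 k kK; rewrite (bigD1 j) //=.
have kj : k != j by apply: contraNneq jZ' => <-; rewrite ck.
have : \sum_(l in K | l != j) A k l * c l <= 0.
  apply: sumr_le0 => l /andP[lK _]; have [<-|kl] := eqVneq k l; first by rewrite ck mulr0.
  by rewrite mulr_le0_ge0 ?A_le0 ?c0.
have cj : 0 < c j by rewrite lt_neqAle c0 // andbT eq_sym.
have := A_le0 kj => ? ? ? Akj; exfalso; have : A k j < 0 by rewrite lt_neqAle Akj.
by nra.
Qed.

End Components.
(** * Finite type *)

Section FiniteType.
Variables (R : realType) (V : vectType R) (n : nat).
Variables (eta : 'I_n -> {scalar V}) (alpha : 'I_n -> V).
Hypothesis eta_alpha : forall i, eta i (alpha i) = 2.

Notation refl := (refl eta alpha).
Notation act := (act eta alpha).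
Notation A := (cartan eta alpha).

Hypothesis A_le0 : forall i j, i != j -> A i j <= 0.

Variable K : {set 'I_n}.

(** Padding the [K]-block with the identity keeps the size [n] and does not change the
    determinant. *)
Definition pairing_mx (v : seq 'I_n) : 'M[R]_n := \matrix_(k, l)
  if (k \in K) && (l \in K) then eta k (act v (alpha l)) else (k == l)%:R.

(** A new first letter multiplies the matrix on the left by [1 - c e], an involution because
    [e c = 2]. Squares make the sign of its determinant irrelevant. *)
Lemma pairing_mx_det (v : seq 'I_n) : {subset v <= K} ->
  \det (pairing_mx v) ^+ 2 = \det (pairing_mx [::]) ^+ 2.
Proof.
elim: v => [//|j v IH] vK; rewrite -IH; last by move=> i iv; rewrite vK // inE iv orbT.
have jK : j \in K by rewrite vK // inE eqxx.
pose c : 'cV[R]_n := \col_k (if k \in K then A k j else 0).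
pose e : 'rV[R]_n := delta_mx 0 j.
have -> : pairing_mx (j :: v) = (1%:M - c *m e) *m pairing_mx v.
  apply/matrixP => k l; rewrite mulmxBl mul1mx -mulmxA !mxE big_ord1.
  rewrite -rowE !mxE jK /=.
  have [kK|kK] /= := boolP (k \in K); last by rewrite mul0r subr0.
  have [lK|lK] := boolP (l \in K); first by rewrite eta_refl mulrC.
  have /negbTE-> : j != l by apply: contraNneq lK => <-.
  by rewrite mulr0 subr0.
have H : (1%:M - c *m e) *m (1%:M - c *m e) = 1%:M.
  rewrite mulmxBl mul1mx mulmxBr mulmx1.
  have ec : e *m c = 2%:M.
    apply/matrixP => a b; rewrite -rowE !mxE jK eta_alpha.
    by rewrite !ord1.
  rewrite -[X in _ - _ - (_ - X)]mulmxA [e *m (c *m e)]mulmxA ec mul_scalar_mx -scalemxAr.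
  rewrite scaler_nat mulr2n (_ : c *m e - (c *m e + c *m e) = - (c *m e)); last by rewrite opprD addrA subrr add0r.
  by rewrite opprK subrK.
have {}H : \det (1%:M - c *m e) ^+ 2 = 1 by rewrite expr2 -det_mulmx H det1.
by rewrite det_mulmx exprMn H mul1r.
Qed.

Hypothesis K_fin : finite_type A K.

(** Diagonal dominance weighted by [u]: a kernel vector is tested in the row where its ratio to [u]
    is largest. *)
Lemma pairing_mx_unit : \det (pairing_mx [::]) != 0.
Proof.
rewrite -det_tr; apply/det0P => -[c c0 /rowP E].
have [u [u0 Au]] := K_fin.
have sumE i : \sum_l pairing_mx [::] i l * c 0 l = 0.
  have := E i; rewrite !mxE => {2}<-.
  by apply: eq_bigr => l _; rewrite [in RHS]mxE mulrC.
have cN i : i \notin K -> c 0 i = 0.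
  move=> iK; have := sumE i; rewrite (bigD1 i) //= !mxE (negbTE iK) eqxx mul1r.
  by rewrite big1 ?addr0 // => l li; rewrite !mxE (negbTE iK) eq_sym (negbTE li) mul0r.
have cK i : i \in K -> \sum_(l in K) A i l * c 0 l = 0.
  move=> iK; rewrite -[RHS](sumE i) [RHS](bigID (mem K)) /= [X in _ + X]big1 ?addr0.
    by apply: eq_bigr => l lK; rewrite !mxE iK lK.
  by move=> l lK; rewrite cN // mulr0.
have [i0 i0K] : exists i0, i0 \in K.
  apply: contrapT => no; move: c0; rewrite (_ : c = 0) ?eqxx //.
  by apply/rowP => i; rewrite mxE cN //; apply/negP => iK; apply: no; exists i.
have [i iK max_i] := @arg_maxP _ _ _ i0 (mem K) (fun l => `|c 0 l| / u l) i0K.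
set t := `|c 0 i| / u i in max_i.
have ct l : l \in K -> `|c 0 l| <= t * u l.
  by move=> lK; rewrite -ler_pdivrMr ?u0 //; exact: max_i.
have ci : `|c 0 i| = t * u i by rewrite /t divfK // gt_eqF // u0.
have t0 : 0 <= t by rewrite /t divr_ge0 // ltW // u0.
have t_eq0 : t = 0.
  apply/eqP; rewrite eq_le t0 andbT leNgt; apply/negP => tp.
  have := cK i iK; rewrite (bigD1 i) //= mxE eta_alpha => /eqP; rewrite addr_eq0 => /eqP H.
  have : `|2 * c 0 i| <= \sum_(l in K | l != i) (- A i l) * (t * u l).
    rewrite H normrN; apply: le_trans (ler_norm_sum _ _ _) _.
    apply: ler_sum => l /andP[lK li]; rewrite normrM ler0_norm; last by rewrite A_le0 // eq_sym.
    by rewrite ler_wpM2l ?ct // oppr_ge0 A_le0 // eq_sym.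
  rewrite normrM ci ger0_norm // => H2.
  have := Au i iK; rewrite (bigD1 i) //= mxE eta_alpha => Ai.
  have : \sum_(l in K | l != i) - A i l * (t * u l) =
    - t * \sum_(l in K | l != i) A i l * u l.
    by rewrite mulr_sumr; apply: eq_bigr => l _; ring.
  move=> E2; rewrite E2 in H2; move: H2 Ai; set s := \sum_(_ in _ | _) _ => H2 Ai; nra.
case/negP: c0; apply/eqP/rowP => l; rewrite mxE.
have [lK|/cN//] := boolP (l \in K).
by apply/normr0_eq0/eqP; rewrite eq_le normr_ge0 andbT; have := ct l lK; rewrite t_eq0 mul0r.
Qed.

Lemma pairing_lower_bound : K != finset.set0 -> exists2 delta, 0 < delta &
  forall v : seq 'I_n, {subset v <= K} ->
    exists k l, [/\ k \in K, l \in K & delta <= `|eta k (act v (alpha l))|].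
Proof.
move=> /finset.set0Pn[k0 k0K].
have D0 : 0 < `|\det (pairing_mx [::])| by rewrite normr_gt0 pairing_mx_unit.
(* If all entries of the [K]-block were at most [d], each of the [n!] terms of the Leibniz formula
   would have a factor at most [d] from row [k0] and the others at most 1, so the determinant would
   be at most half of its true absolute value. *)
pose d := Num.min 1 (`|\det (pairing_mx [::])| / (2 * (n`!)%:R)).
have f0 : 0 < (n`!)%:R :> R by rewrite ltr0n fact_gt0.
have d0 : 0 < d by rewrite lt_min ltr01 /= divr_gt0 // mulr_gt0.
exists d => // v vK; apply: contrapT => no.
have small k l : k \in K -> l \in K -> `|eta k (act v (alpha l))| <= d.
  move=> kK lK; rewrite leNgt; apply/negP => /ltW H.
  by apply: no; exists k, l.
have d1 : d <= 1 by rewrite ge_min lexx.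
have Dv : `|\det (pairing_mx v)| = `|\det (pairing_mx [::])|.
  apply/eqP; rewrite -(@eqrXn2 _ 2) // -!normrX; apply/eqP; congr `|_|.
  exact: pairing_mx_det.
have : `|\det (pairing_mx v)| <= (n`!)%:R * d.
  apply: le_trans (ler_norm_sum _ _ _) _.
  rewrite -[X in X%:R * d](@card_Sn n) -sum1_card natr_sum mulr_suml.
  rewrite [leRHS](_ : _ = \sum_(s : 'S_n) d); last first.
    by apply: eq_big => // s _; rewrite mul1r.
  apply: ler_sum => s _; rewrite normrM normrX normrN1 expr1n mul1r normr_prod.
  rewrite (bigD1 k0) //= -[leRHS]mulr1; apply: ler_pM => //; first exact: prodr_ge0.
    rewrite mxE k0K /=; case: ifP => [sK|sK]; first exact: small.
    have /negbTE-> : k0 != s k0 by apply: contraFneq sK => <-.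
    by rewrite normr0 ltW.
  apply: prodr_ile1 => i _; rewrite normr_ge0 mxE /=.
  case: ifP => [/andP[iK sK]|_]; first exact: le_trans (small _ _ iK sK) d1.
  by case: (_ == _); rewrite ?normr1 ?normr0.
rewrite Dv => H; have : (n`!)%:R * d <= `|\det (pairing_mx [::])| / 2.
  have : d <= `|\det (pairing_mx [::])| / (2 * (n`!)%:R) by rewrite ge_min lexx orbT.
  by rewrite ler_pdivlMr ?mulr_gt0 // => ?; rewrite ler_pdivlMr //; nra.
lra.
Qed.

Hypothesis K_conn : connected A K.

(** Comparing a small functional before and after [refl k] bounds [eta k], up to the coefficient on
    [alpha k]. This starts with [beta] at [j0] and then passes from [eta j] to a neighbour; each new
    index costs one letter, whence [size u + d]. The constant [C] is chosen before [beta], [y] and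
    [e]. *)
Lemma connected_spread d : (d < #|K|)%N -> forall U, 0 < U -> exists2 C, 0 <= C &
  forall (beta : {scalar V}) y e j0, j0 \in K -> 1 <= beta (alpha j0) * U ->
    (forall u : seq 'I_n, {subset u <= K} -> (size u <= #|K|)%N ->
       `|beta (act u y)| <= e) ->
    exists2 S : {set 'I_n}, S \subset K /\ (d < #|S|)%N &
      forall k u, k \in S -> {subset u <= K} -> (size u + d < #|K|)%N ->
        `|eta k (act u y)| <= C * e.
Proof.
elim: d => [|d IH] dK U U0.
  exists (2 * U) => [|beta y e j0 j0K bj Hu]; first by rewrite mulr_ge0 // ltW.
  exists [set j0]%SET; first by rewrite finset.sub1set cards1.
  move=> k u; rewrite inE addn0 => /eqP -> uK su.
  have H1 := Hu u uK (ltnW su).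
  have H2 : `|beta (act (j0 :: u) y)| <= e.
    by apply: Hu => // i; rewrite inE => /orP[/eqP ->//|/uK].
  move: H1 H2; rewrite act_cons reflE linearB /= linearZ_LR /= => H1 H2.
  set x := act u y in H1 H2 *; set b := beta (alpha j0) in bj H2.
  have b0 : 0 < b by nra.
  have : `|eta j0 x * b| <= 2 * e.
    move: H1 H2; rewrite !ler_norml; move=> /andP[? ?] /andP[? ?].
    by apply/andP; split; lra.
  rewrite normrM (gtr0_norm b0) => H.
  have := normr_ge0 (eta j0 x); nra.
have [C C0 HC] := IH (ltnW dK) U U0.
(* A uniform bound for the inverses of the nonzero entries; a zero entry contributes 0, since the
   inverse of 0 is 0 here. *)
pose a := \sum_(i : 'I_n) \sum_(j : 'I_n) `|A i j|^-1.
have a0 i j : `|A i j|^-1 <= a.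
  rewrite /a (bigD1 i) //= (bigD1 j) //= -addrA lerDl addr_ge0 //.
    by apply: sumr_ge0 => *; rewrite invr_ge0.
  by apply: sumr_ge0 => *; apply: sumr_ge0 => *; rewrite invr_ge0.
have a_ge0 : 0 <= a by apply: sumr_ge0 => *; apply: sumr_ge0 => *; rewrite invr_ge0.
exists (C + 2 * C * a) => [|beta y e j0 j0K bj Hu].
  by rewrite addr_ge0 ?mulr_ge0.
have [S [SK dS] HS] := HC beta y e j0 j0K bj Hu.
have e0 : 0 <= e by apply: le_trans (Hu [::] _ _).
have Ce : C * e <= (C + 2 * C * a) * e by rewrite ler_wpM2r // lerDl !mulr_ge0.
have [S1|S1] := ltnP d.+1 #|S|.
  exists S => // k u kS uK su; apply: le_trans Ce; apply: HS => //.
  by rewrite addnS in su; exact: ltnW.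
have /connectedP[_ cn] := K_conn.
have [||j [k [jS kS Ajk]]] := cn S SK.
- by rewrite -finset.card_gt0 (leq_ltn_trans _ dS).
- by apply: contraTneq dK => <-; rewrite -leqNgt.
move: kS; rewrite inE => /andP[kS kK].
exists (k |: S)%SET.
  by rewrite finset.subUset finset.sub1set kK SK cardsU1 kS add1n ltnS.
move=> l u; rewrite !inE => /orP[/eqP ->|lS] uK su; last first.
  by apply: le_trans Ce; apply: HS => //; rewrite addnS in su; exact: ltnW.
have H1 : `|eta j (act u y)| <= C * e.
  by apply: HS => //; rewrite addnS in su; exact: ltnW.
have H2 : `|eta j (act (k :: u) y)| <= C * e.
  apply: HS => //; last by rewrite /= addSn -addnS.
  by move=> i; rewrite inE => /orP[/eqP ->|/uK].
move: H1 H2; rewrite act_cons eta_refl; set x := act u y => H1 H2.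
have Aj0 : 0 < `|A j k| by rewrite normr_gt0.
have : `|eta k x| * `|A j k| <= 2 * C * e.
  rewrite -normrM mxE; move: H1 H2; rewrite !ler_norml => /andP[? ?] /andP[? ?].
  by apply/andP; split; lra.
rewrite -ler_pdivlMr // => H; apply: le_trans H _.
have Ce0 : 0 <= C * e by rewrite mulr_ge0.
apply: (@le_trans _ _ (2 * C * e * a)); last by lra.
by rewrite ler_wpM2l // -mulrA mulr_ge0.
Qed.

Variable J : {set 'I_n}.
Hypothesis KJ : K \subset J.
Hypothesis K_sep : forall i k, i \in J :\: K -> k \in K -> A i k = 0.
Variable c : 'I_n -> R.
Hypothesis c_gt0 : forall j, j \in K -> 0 < c j.
Hypothesis Ac_gt0 : forall i, i \in K -> 0 < \sum_(j in K) A i j * c j.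

(** This vector serves as an order unit: its values are positive on [K] and vanish on the rest of
    [J]. *)
Let x0 : V := \sum_(j in K) c j *: alpha j.

Lemma eta_x0 i : i \in K -> 0 < eta i x0.
Proof. by move=> iK; rewrite eta_sum Ac_gt0. Qed.

Definition vanish_off (x : V) := forall i, i \in J :\: K -> eta i x = 0.

Lemma vanish_off_alpha k : k \in K -> vanish_off (alpha k).
Proof. by move=> kK i iJ; have := K_sep iJ kK; rewrite mxE. Qed.

Lemma vanish_off_x0 : vanish_off x0.
Proof.
move=> i iJ; rewrite linear_sum big1 // => j jK.
by rewrite linearZ_LR /= vanish_off_alpha ?mulr0.
Qed.

(** Letters outside [K] fix such vectors, and letters in [K] move them along roots that vanish off
    [K] themselves. *)
Lemma vanish_off_act w x : {subset w <= J} -> vanish_off x -> vanish_off (act w x).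
Proof.
move=> wJ Zx; elim: w wJ => [//|j w IH] wJ.
have {}IH : vanish_off (act w x) by apply: IH => i iw; rewrite wJ // inE iw orbT.
have jJ : j \in J by rewrite wJ // inE eqxx.
rewrite act_cons; have [jK|jK] := boolP (j \in K); last first.
  by rewrite refl_fix // IH // inE jK.
by move=> i iJ; rewrite eta_refl IH // vanish_off_alpha // mulr0 subr0.
Qed.

Definition domination (x : V) : R := \sum_(i in K) `|eta i x| / eta i x0.

Lemma domination_ge0 x : 0 <= domination x.
Proof. by apply: sumr_ge0 => i iK; rewrite divr_ge0 // ltW // eta_x0. Qed.

(** Both [domination x *: x0 - x] and [domination x *: x0 + x] lie in the cone on which [gamma] is
    nonnegative. *)
Lemma dominated (gamma : {scalar V}) x : vanish_off x ->
  (forall y, dom eta J y -> 0 <= gamma y) -> `|gamma x| <= domination x * gamma x0.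
Proof.
move=> Zx G; have H i : i \in J -> `|eta i x| <= domination x * eta i x0.
  move=> iJ; have [iK|iK] := boolP (i \in K); last first.
    by rewrite Zx ?vanish_off_x0 ?mulr0 ?normr0 // inE iK.
  rewrite -ler_pdivrMr ?eta_x0 // /domination (bigD1 i) //= lerDl.
  by apply: sumr_ge0 => j /andP[jK _]; rewrite divr_ge0 // ltW // eta_x0.
have D1 : dom eta J (domination x *: x0 - x).
  move=> i iJ; rewrite linearB /= linearZ_LR /= subr_ge0.
  by apply: le_trans (H i iJ); rewrite ler_norm.
have D2 : dom eta J (domination x *: x0 + x).
  move=> i iJ; rewrite linearD /= linearZ_LR /= -[X in _ + X]opprK subr_ge0.
  by apply: le_trans (H i iJ); rewrite ler_normr lexx orbT.
have := G _ D1; have := G _ D2.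
rewrite linearB linearD /= linearZ_LR /= ler_norml => ? ?.
by apply/andP; split; lra.
Qed.

Lemma dom_x0 : dom eta J x0.
Proof.
move=> i iJ; have [/eta_x0/ltW//|iK] := boolP (i \in K).
by rewrite vanish_off_x0 // inE iK.
Qed.

(** The weights satisfy [t j * eta j x0 = c j], so the correction terms of the reflections add up to
    [x0]. The cut at 0 in [rho] covers the case [T < 1]. *)
Let t j := c j / eta j x0.
Let T := \sum_(j in K) t j.
Let rho := Num.max 0 ((T - 1) / T).

(* [x0] is an eigenvector of the average of the reflections, with an eigenvalue
   smaller than [1]; so some reflection contracts every functional at [x0]. *)
Lemma average_refl : \sum_(j in K) t j *: refl j x0 = (T - 1) *: x0.
Proof.
rewrite scalerBl scale1r {1}/T scaler_suml -sumrB; apply: eq_bigr => j jK.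
by rewrite reflE scalerBr scalerA /t divfK // gt_eqF // eta_x0.
Qed.

Lemma t_gt0 j : j \in K -> 0 < t j.
Proof. by move=> jK; rewrite divr_gt0 ?c_gt0 ?eta_x0. Qed.

Hypothesis K_neq0 : K != finset.set0.

Lemma T_gt0 : 0 < T.
Proof.
have /finset.set0Pn[k kK] := K_neq0.
rewrite /T (bigD1 k) //= ltr_pwDl ?t_gt0 //.
by apply: sumr_ge0 => j /andP[jK _]; rewrite ltW // t_gt0.
Qed.

Lemma rho_ge0 : 0 <= rho. Proof. by rewrite le_max lexx. Qed.

Lemma rho_lt1 : rho < 1.
Proof. by rewrite gt_max ltr01 /= ltr_pdivrMr ?T_gt0 // mul1r ltrBlDr ltrDl. Qed.

Lemma greedy_step (gamma : {scalar V}) : 0 <= gamma x0 ->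
  exists2 j, j \in K & gamma (refl j x0) <= rho * gamma x0.
Proof.
move=> g0; apply: contrapT => no.
have H j : j \in K -> (T - 1) / T * gamma x0 < gamma (refl j x0).
  move=> jK; apply: contrapT => /negP; rewrite -leNgt => H; apply: no; exists j => //.
  by apply: le_trans H _; rewrite ler_wpM2r // le_max lexx orbT.
have := congr1 gamma average_refl; rewrite linear_sum /= linearZ_LR /=.
apply/eqP; rewrite gt_eqF //.
rewrite (eq_bigr (fun j => t j * gamma (refl j x0))); last by move=> j _; rewrite linearZ_LR.
have -> : (T - 1) * gamma x0 = \sum_(j in K) t j * ((T - 1) / T * gamma x0).
  by rewrite -mulr_suml -/T mulrA mulrCA divff ?mulr1 // gt_eqF // T_gt0.
have /finset.set0Pn[k kK] := K_neq0.
rewrite (bigD1 k) //= [ltRHS](bigD1 k) //= ltr_leD ?ltr_pM2l ?t_gt0 ?H //.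
by apply: ler_sum => j /andP[jK _]; rewrite ler_pM2l ?t_gt0 // ltW // H.
Qed.

(** The word grows on the right, next to [x0]: [greedy_step] applies to any functional, in
    particular to [gamma \o act v], but only at [x0]. *)
Lemma greedy (gamma : {scalar V}) m :
  (forall v : seq 'I_n, {subset v <= K} -> (size v <= m)%N -> 0 <= gamma (act v x0)) ->
  exists v : seq 'I_n, [/\ {subset v <= K}, (size v <= m)%N &
    gamma (act v x0) <= rho ^+ m * gamma x0].
Proof.
elim: m => [|m IH] G; first by exists [::]; rewrite mul1r.
have [v vK sv|v [vK sv Hv]] := IH; first by apply: G => //; exact: leqW.
have [|j jK Hj] := @greedy_step (gamma \o act v); first exact: G (leqW sv).
exists (rcons v j); split.
- by move=> i; rewrite mem_rcons inE => /orP[/eqP ->|/vK].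
- by rewrite size_rcons.
rewrite act_rcons; apply: le_trans Hj _; rewrite exprS -mulrA.
by rewrite ler_wpM2l ?rho_ge0.
Qed.

Lemma rho_small e : 0 < e -> exists m, rho ^+ m < e.
Proof.
move=> e0; have r0 := rho_ge0; have r1 := rho_lt1.
have B m : m%:R * (1 - rho) * rho ^+ m <= 1.
  suff : m%:R * (1 - rho) * rho ^+ m <= 1 - rho ^+ m.
    by move=> H; apply: le_trans H _; rewrite gerBl exprn_ge0.
  elim: m => [|m IH]; first by rewrite !mul0r expr0 subrr.
  rewrite exprS -addn1 natrD; have := exprn_ge0 m r0.
  set p := rho ^+ m in IH *; set q := m%:R in IH * => p0.
  have q0 : 0 <= q by exact: ler0n.
  have : rho * (q * (1 - rho) * p) <= rho * (1 - p) by rewrite ler_wpM2l.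
  have : 0 <= (1 - rho) * (1 - rho) * p by rewrite !mulr_ge0 //; lra.
  nra.
pose m := Num.bound ((1 - rho)^-1 / e).
exists m; have := @archi_boundP _ ((1 - rho)^-1 / e); rewrite -/m.
rewrite divr_ge0 ?invr_ge0 ?subr_ge0 ?(ltW r1) ?(ltW e0) // => /(_ isT).
rewrite ltr_pdivrMr // -[X in X < _]mul1r ltr_pdivrMr ?subr_gt0 //.
have := B m; set q := m%:R; set p := rho ^+ m => H1 H2.
rewrite ltNge; apply/negP => ep.
have : 0 < 1 - rho by lra.
have q0 : 0 <= q by exact: ler0n.
move=> r'; have : q * (1 - rho) * e <= 1.
  by apply: le_trans H1; rewrite ler_wpM2l // mulr_ge0 // ltW.
nra.
Qed.

(** When all terms are nonnegative, a bound on this single number bounds [beta (act u x)] for every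
    short [u] at once, as [connected_spread] requires. *)
Definition orbit_sum (beta : {scalar V}) (x : V) : R :=
  \sum_(u : #|K|.-bseq 'I_n | all (mem K) u) beta (act u x).

Lemma orbit_sum_is_scalar beta : scalar (orbit_sum beta).
Proof.
move=> a x y; rewrite /orbit_sum mulr_sumr -big_split /=.
by apply: eq_bigr => u _; rewrite !linearP.
Qed.

HB.instance Definition _ beta := GRing.isLinear.Build R V R *%R (orbit_sum beta)
  (orbit_sum_is_scalar beta).

(* A functional positive along all short words is contracted by a long greedy word;
   by connectedness the pairing matrix of that word becomes small, although its
   determinant has constant absolute value. *)
Lemma positive_orbit_bound1 : exists N, forall beta : {scalar V},
  (forall (u : seq 'I_n) x, {subset u <= K} -> (size u <= N)%N -> dom eta J x ->
     0 <= beta (act u x)) -> beta x0 != 1.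
Proof.
have [delta d0 Hd] := pairing_lower_bound K_neq0.
have K0 : (0 < #|K|)%N by rewrite finset.card_gt0.
pose U := \sum_(j in K) c j.
have U0 : 0 < U.
  have /finset.set0Pn[k kK] := K_neq0.
  rewrite /U (bigD1 k) //= ltr_pwDl ?c_gt0 //.
  by apply: sumr_ge0 => j /andP[jK _]; rewrite ltW // c_gt0.
have [C C0 HC] := @connected_spread #|K|.-1 (eq_leq (prednK K0)) U U0.
pose M := \sum_(l in K) domination (alpha l).
have M0 : 0 <= M by apply: sumr_ge0 => *; exact: domination_ge0.
pose C1 := \sum_(u : #|K|.-bseq 'I_n | all (mem K) u) domination (act u x0).
have C10 : 0 <= C1 by apply: sumr_ge0 => *; exact: domination_ge0.
have X0 : 0 < C * M * C1 + 1 by rewrite ltr_wpDl ?mulr_ge0.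
(* Chosen so that [C * (M * (rho ^+ m * C1)) < delta], against [pairing_lower_bound]; the added 1
   keeps the denominator positive. *)
have [m Hm] := @rho_small (delta / (C * M * C1 + 1)) (divr_gt0 d0 X0).
(* A word of [orbit_sum], of length at most [#|K|], is followed by a greedy word of length at most
   [m]. *)
exists (#|K| + m)%N => beta B; apply/eqP => b1.
have allK (u : seq 'I_n) : {subset u <= K} -> all (mem K) u by move=> uK; apply/allP.
have B' (u v : seq 'I_n) x : {subset u <= K} -> {subset v <= K} ->
    (size u <= #|K|)%N -> (size v <= m)%N -> dom eta J x -> 0 <= beta (act u (act v x)).
  move=> uK vK su sv Dx; rewrite -act_cat; apply: B => //; last by rewrite size_cat leq_add.
  by move=> i; rewrite mem_cat => /orP[/uK|/vK].
have [v [vK sv Hv]] : exists v : seq 'I_n, [/\ {subset v <= K}, (size v <= m)%N &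
    orbit_sum beta (act v x0) <= rho ^+ m * orbit_sum beta x0].
  apply: (@greedy (orbit_sum beta)) => v vK sv; apply: sumr_ge0 => u /allP uK.
  by apply: B' => //; [exact: size_bseq|exact: dom_x0].
have C1b : orbit_sum beta x0 <= C1.
  apply: ler_sum => u /allP uK; apply: le_trans (ler_norm _) _.
  rewrite -[leRHS]mulr1 -b1; apply: dominated.
    by apply: vanish_off_act vanish_off_x0 => i /uK; exact: (fintype.subsetP KJ).
  by move=> y Dy; apply: (B [::]).
have {Hv}C1b : orbit_sum beta (act v x0) <= rho ^+ m * C1.
  by apply: le_trans Hv _; rewrite ler_wpM2l // exprn_ge0 // rho_ge0.
have [k [l [kK lK Hkl]]] := Hd v vK.
pose e := M * (rho ^+ m * C1).
have He (u : seq 'I_n) : {subset u <= K} -> (size u <= #|K|)%N ->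
    `|beta (act u (act v (alpha l)))| <= e.
  move=> uK su; have := @dominated (beta \o (act u \o act v)) (alpha l) (vanish_off_alpha lK).
  move=> /(_ (fun y Dy => B' u v y uK vK su sv Dy)) /= H; apply: le_trans H _.
  apply: ler_pM; first exact: domination_ge0.
  - by apply: B' => //; exact: dom_x0.
  - rewrite /M (bigD1 l) //= lerDl.
    by apply: sumr_ge0 => *; exact: domination_ge0.
  apply: le_trans C1b; rewrite /orbit_sum (bigD1 (Bseq su)) ?allK //= lerDl.
  apply: sumr_ge0 => w /andP[/allP wK _]; apply: B' => //; last exact: dom_x0.
  exact: size_bseq.
(* The normalization [beta x0 = 1] says that the values [beta (alpha j)] have [c]-weighted sum 1, so
   one of them is at least [1 / U]. *)
have [j0 j0K Hj0] : exists2 j0, j0 \in K & 1 <= beta (alpha j0) * U.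
  apply: contrapT => no; have H j : j \in K -> beta (alpha j) * U < 1.
    by move=> jK; rewrite ltNge; apply/negP => H; apply: no; exists j.
  have : \sum_(j in K) c j * (beta (alpha j) * U) < \sum_(j in K) c j * 1.
    have /finset.set0Pn[i iK] := K_neq0.
    rewrite (bigD1 i) //= [ltRHS](bigD1 i) //= ltr_leD ?ltr_pM2l ?c_gt0 ?H //.
    by apply: ler_sum => j /andP[jK _]; rewrite ler_pM2l ?c_gt0 // ltW // H.
  have b1' : \sum_(j in K) c j * beta (alpha j) = 1.
    by rewrite -b1 linear_sum; apply: eq_bigr => j _; rewrite linearZ_LR.
  rewrite (eq_bigr (fun j => c j * beta (alpha j) * U)) => [|j _]; last by rewrite mulrA.
  by rewrite -!mulr_suml b1' mul1r mulr1 ltxx.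
have [S [SK dS] HS] := HC beta (act v (alpha l)) e j0 j0K Hj0 He.
have SE : S = K by apply/eqP; rewrite finset.eqEcard SK -(prednK K0).
have := HS k [::]; rewrite SE => /(_ kK) /(_ (fun i ib => False_ind _ (notF ib))).
rewrite /= add0n => /(_ (eq_leq (prednK K0))) Hk.
have : delta <= C * e by exact: le_trans Hkl Hk.
rewrite leNgt => /negP; apply.
rewrite ltr_pdivlMr // in Hm; apply: le_lt_trans Hm.
rewrite /e; have := exprn_ge0 m rho_ge0; set p := rho ^+ m => p0.
rewrite (_ : C * (M * (p * C1)) = p * (C * M * C1)); last ring.
by rewrite ler_wpM2l // lerDl.
Qed.

(** Rescaling reduces [beta x0 > 0] to the excluded value 1; once [beta x0 = 0], domination by [x0]
    kills [beta]. *)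
Lemma positive_orbit_bound : exists N, forall beta : {scalar V},
  (forall (u : seq 'I_n) x, {subset u <= K} -> (size u <= N)%N -> dom eta J x ->
     0 <= beta (act u x)) -> forall x, vanish_off x -> beta x = 0.
Proof.
have [N HN] := positive_orbit_bound1; exists N => beta B x Zx.
have b0 : 0 <= beta x0 by apply: (B [::]) => //; exact: dom_x0.
apply/normr0_eq0/eqP; rewrite eq_le normr_ge0 andbT.
have H := @dominated beta x Zx (fun y Dy => B [::] y (fun i ib => False_ind _ (notF ib)) isT Dy).
apply: le_trans H _; suff -> : beta x0 = 0 by rewrite mulr0.
apply/eqP; rewrite eq_le b0 andbT leNgt; apply/negP => bp.
have F : (beta \o *:%R (beta x0)^-1) x0 = 1.
  by rewrite /= linearZ_LR /= mulVf // gt_eqF.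
suff : (beta \o *:%R (beta x0)^-1) x0 != 1 by rewrite F eqxx.
apply: HN => u y uK su Dy.
by rewrite /= linearZ_LR /= mulr_ge0 ?invr_ge0 // B.
Qed.

End FiniteType.

(** * Faces of convex cones *)

Section ConvexCones.
Variables (R : realType) (V : vectType R).
Implicit Types (x y z : V) (S K F G Y : set V).

Lemma spanning_seq S : exists v : seq V,
  [/\ forall x, x \in v -> S x, free v & forall x, S x -> x \in <<v>>%VS].
Proof.
suff H m (v : seq V) : (\dim (fullv : {vspace V}) - size v < m)%N ->
    (forall x, x \in v -> S x) -> free v -> exists v : seq V,
    [/\ forall x, x \in v -> S x, free v & forall x, S x -> x \in <<v>>%VS].
  by apply: (H _ [::] (ltnSn _)); rewrite ?nil_free.
elim: m v => // m IH v vm Sv fv.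
have [H|] := pselect (forall x, S x -> x \in <<v>>%VS); first by exists v.
move=> /existsNP[x /not_implyP[Sx /negP xv]].
have fxv : free (x :: v) by rewrite free_cons xv.
apply: (IH (x :: v)) => //; last first.
  by move=> y; rewrite inE => /orP[/eqP ->|/Sv].
have : (size (x :: v) <= \dim (fullv : {vspace V}))%N.
  by rewrite -(eqP fxv) dimvS ?subvf.
by move: vm => /=; rewrite !ltnS => H1 H2; rewrite (leq_trans _ H1) // ltn_sub2l.
Qed.

Lemma lin_hullE S (v : seq V) : (forall x, x \in v -> S x) ->
  (forall x, S x -> x \in <<v>>%VS) -> lin_hull S = <<v>>%VS.
Proof.
move=> vS Sv; rewrite /lin_hull.
have H : [set U : {vspace V} | (forall x, S x -> x \in U) /\
    (forall U' : {vspace V}, (forall x, S x -> x \in U') -> (U <= U')%VS)] <<v>>%VS.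
  by split => // U' SU; apply/span_subvP => x /vS/SU.
case: xgetP => [U _ [SU minU]|/(_ _ H)//].
apply: subv_anti; apply/andP; split; first exact: minU.
by case: H => _; apply.
Qed.

Lemma lin_hullP S : (forall x, S x -> x \in lin_hull S) /\
  (forall U : {vspace V}, (forall x, S x -> x \in U) -> (lin_hull S <= U)%VS).
Proof.
have [v [vS _ Sv]] := spanning_seq S; rewrite (lin_hullE vS Sv); split => // U SU.
by apply/span_subvP => x /vS/SU.
Qed.

Lemma mem_lin_hull S x : S x -> x \in lin_hull S.
Proof. by have [H _] := lin_hullP S; exact: H. Qed.

Lemma lin_hull_sub S (U : {vspace V}) : (forall x, S x -> x \in U) ->
  (lin_hull S <= U)%VS.
Proof. by have [_ H] := lin_hullP S; exact: H. Qed.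

Lemma lin_hullS S1 S2 : S1 `<=` S2 -> (lin_hull S1 <= lin_hull S2)%VS.
Proof. by move=> H; apply: lin_hull_sub => x /H/mem_lin_hull. Qed.

Lemma convex_coneZ K a x : convex_cone K -> K 0 -> 0 <= a -> K x -> K (a *: x).
Proof.
move=> [_ cZ] K0; rewrite le_eqVlt => /orP[/eqP <-|a0] Kx; last exact: cZ.
by rewrite scale0r.
Qed.

Lemma convex_cone_sum K (T : finType) (P : pred T) (c : T -> R) (v : T -> V) :
  convex_cone K -> K 0 -> (forall i, P i -> 0 <= c i) -> (forall i, P i -> 0 < c i -> K (v i)) ->
  K (\sum_(i | P i) c i *: v i).
Proof.
move=> cK K0 c0 Kv; apply: (big_ind K) => [//||i Pi]; first exact: cK.1.
have := c0 i Pi; rewrite le_eqVlt => /orP[/eqP <-|ci]; first by rewrite scale0r.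
by apply: cK.2 => //; exact: Kv.
Qed.

Lemma lin_hull_cone K x : convex_cone K -> K 0 -> x \in lin_hull K ->
  exists a b, [/\ K a, K b & x = a - b].
Proof.
move=> cK K0; have [v [vK _ Kv]] := spanning_seq K; rewrite (lin_hullE vK Kv).
pose X := in_tuple v => xv; have xE : x = \sum_(i < size v) coord X i x *: X`_i by exact: coord_span.
pose c (i : 'I_(size v)) := coord X i x.
have vK' (i : 'I_(size v)) : K X`_i by apply: vK; apply: (@mem_nth _ 0 v); exact: ltn_ord.
exists (\sum_i (if 0 <= c i then c i else 0) *: X`_i),
       (\sum_i (if 0 <= c i then 0 else - c i) *: X`_i); split.
- by apply: convex_cone_sum => // i _; case: ifP.
- apply: convex_cone_sum => // i _; case: (leP 0 (c i)) => // /ltW ?.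
  by rewrite oppr_ge0.
- rewrite -sumrB {1}xE; apply: eq_bigr => i _; rewrite -scalerBl; congr (_ *: _).
  by rewrite -/(c i); case: ifP => _; rewrite ?subr0 // sub0r opprK.
Qed.

Lemma face_cone Y F : Fa Y F -> convex_cone F. Proof. by move=> [[]]. Qed.

Lemma face_sub Y F : Fa Y F -> F `<=` Y. Proof. by move=> [[]]. Qed.

Lemma face0 Y F : Y 0 -> Fa Y F -> F 0.
Proof.
move=> Y0 [[cF FY H] [x Fx]]; apply: contrapT => F0.
by have := H 0 x (conj Y0 F0) (FY _ Fx); rewrite add0r => -[].
Qed.

Lemma face_addl Y F x y : Fa Y F -> Y x -> Y y -> F (x + y) -> F x.
Proof.
move=> [[_ _ H] _] Yx Yy Fxy; apply: contrapT => Fx.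
by have [] := H x y (conj Yx Fx) Yy.
Qed.

Lemma face_addr Y F x y : Fa Y F -> Y x -> Y y -> F (x + y) -> F y.
Proof. by move=> fF Yx Yy; rewrite addrC; exact: face_addl fF Yy Yx. Qed.

Lemma face_scale Y F a x : Fa Y F -> 0 < a -> F (a *: x) -> F x.
Proof.
move=> /face_cone[_ cZ] a0 Fx; rewrite -[x]scale1r -(@mulVf _ a) ?gt_eqF //.
by rewrite -scalerA; apply: cZ => //; rewrite invr_gt0.
Qed.

(** If [x = a - b] with [a] and [b] in [F], then [x + b] lies in [F], and the face property returns
    [x]. *)
Lemma face_lin_hull Y F x : Y 0 -> Fa Y F -> Y x -> x \in lin_hull F -> F x.
Proof.
move=> Y0 fF Yx /(lin_hull_cone (face_cone fF) (face0 Y0 fF))[a [b [Fa Fb E]]].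
by apply: (face_addl fF Yx (face_sub fF Fb)); rewrite E subrK.
Qed.

Lemma cone_dim_mono Y F G : Y 0 -> Fa Y F -> Fa Y G -> F `<` G ->
  (cone_dim F < cone_dim G)%N.
Proof.
move=> Y0 fF fG [FG GF]; have HS := lin_hullS FG.
rewrite /cone_dim ltn_neqAle dimvS // andbT; apply/negP => E; apply: GF => x Gx.
apply: (face_lin_hull Y0 fF (face_sub fG Gx)).
by have /eqP -> : lin_hull F == lin_hull G; [rewrite eqEdim HS (eqP E) leqnn|exact: mem_lin_hull].
Qed.

(** The relative interior without a norm ([core_relint]); in this form it interacts directly with
    the face property and with linear bijections. *)
Definition core F x := F x /\ forall y, F y -> exists2 t : R, 0 < t & F (x - t *: y).

Lemma core_sub F x : core F x -> F x. Proof. by case. Qed.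

Lemma core_exists F : convex_cone F -> F 0 -> exists x, core F x.
Proof.
move=> cF F0; have [v [vF _ Fv]] := spanning_seq F; pose X := in_tuple v.
have XF (i : 'I_(size v)) : F X`_i by apply: vF; apply: (@mem_nth _ 0 v); exact: ltn_ord.
exists (\sum_(i < size v) 1 *: X`_i); split; first exact: convex_cone_sum.
move=> y /Fv yv; have yE : y = \sum_(i < size v) coord X i y *: X`_i by exact: coord_span.
pose c (i : 'I_(size v)) := coord X i y.
pose s := 1 + \sum_i `|c i|.
have cs i : `|c i| < s.
  rewrite /s (bigD1 i) //= addrCA -[ltLHS]addr0 ltrD2l ltr_pwDl //.
  by apply: sumr_ge0.
have s0 : 0 < s by rewrite ltr_pwDl // sumr_ge0.
exists s^-1; first by rewrite invr_gt0.
rewrite yE scaler_sumr -sumrB.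
rewrite (eq_bigr (fun i => (1 - s^-1 * c i) *: X`_i)); last first.
  by move=> i _; rewrite scalerA -scalerBl.
apply: convex_cone_sum => // i _.
rewrite subr_ge0 mulrC ler_pdivrMr // mul1r ltW // (le_lt_trans _ (cs i)) //.
exact: ler_norm.
Qed.

Lemma core_comb F x y a b : convex_cone F -> F 0 -> core F x -> F y -> 0 < a -> 0 <= b ->
  core F (a *: x + b *: y).
Proof.
move=> cF F0 [Fx Cx] Fy a0 b0.
have Fb : F (b *: y) by exact: convex_coneZ.
split; first by apply: cF.1 => //; exact: cF.2.
move=> z /Cx[t t0 Ft]; exists (a * t); first exact: mulr_gt0.
by rewrite -scalerA addrAC -scalerBr; apply: cF.1 => //; exact: cF.2.
Qed.

Lemma core_face_sub Y F G x : convex_cone Y -> Y 0 -> Fa Y F -> Fa Y G ->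
  core F x -> G x -> F `<=` G.
Proof.
move=> cY Y0 fF fG [Fx Cx] Gx y Fy; have [t t0 Ft] := Cx y Fy.
apply: (face_scale fG t0).
have E : x = t *: y + (x - t *: y) by rewrite addrC subrK.
rewrite E in Gx; apply: (face_addl fG _ _ Gx).
- by apply: cY.2 => //; exact: face_sub fF _ Fy.
- exact: face_sub fF _ Ft.
Qed.

Lemma core_face_eq Y F G x : convex_cone Y -> Y 0 -> Fa Y F -> Fa Y G ->
  core F x -> core G x -> F = G.
Proof.
move=> cY Y0 fF fG CF CG; apply/seteqP; split.
- exact: (core_face_sub cY Y0 fF fG CF (core_sub CG)).
- exact: (core_face_sub cY Y0 fG fF CG (core_sub CF)).
Qed.

Lemma core_relint F x : convex_cone F -> F 0 -> relint F x <-> core F x.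
Proof.
move=> cF F0; split=> [[Fx [e e0 H]]|[Fx Cx]]; split => //.
  move=> y Fy; pose E := vbasis (fullv : {vspace V}).
  pose s := 1 + \sum_i `|coord E i y|.
  have s0 : 0 < s by rewrite ltr_pwDl // sumr_ge0.
  exists (e / s); first exact: divr_gt0.
  apply: H => [|i].
    (* The point [0] of [F] takes up the missing weight, so the coefficients sum to 1. *)
    exists 3, (fun i : 'I_3 => [:: x; y; 0]`_i), (fun i : 'I_3 => [:: 1; - (e / s); e / s]`_i).
    split.
    - by move=> i; case: i => [[|[|[|]]]].
    - by rewrite !big_ord_recl big_ord0 /= addr0 addNr addr0.
    - by rewrite !big_ord_recl big_ord0 /= scale1r scaleNr scaler0 !addr0.
  rewrite addrAC subrr add0r -scaleNr linearZ /= normrM normrN [`|e / s|]gtr0_norm ?divr_gt0 //.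
  rewrite -mulrA gtr_pMr // mulrC ltr_pdivrMr // mul1r /s (bigD1 i) //= addrCA.
  by rewrite -[ltLHS]addr0 ltrD2l ltr_pwDl // sumr_ge0.
have [v [vF fv Fv]] := spanning_seq F; pose X := in_tuple v; pose m := size v.
have XF (i : 'I_(size v)) : F X`_i by apply: vF; apply: (@mem_nth _ 0 v); exact: ltn_ord.
have /choice[t Ht] : forall i : 'I_m, exists t : R, 0 < t /\ F (x - t *: X`_i).
  by move=> i; have [t t0 Ft] := Cx _ (XF i); exists t.
pose E := vbasis (fullv : {vspace V}).
(* [B i] bounds the [i]-th coordinate in [X] by the sup norm of the coordinates in [E]. *)
pose B i := 1 + \sum_(k < \dim (fullv : {vspace V})) `|coord X i E`_k|.
have B0 i : 0 < B i by rewrite ltr_pwDl // sumr_ge0.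
have m0 : 0 < (m.+1)%:R :> R by rewrite ltr0n.
pose e := \big[Num.min/1]_(i < m) (t i / m.+1%:R / B i).
exists e.
  rewrite lt_bigmin ?ltr01 // => i _; rewrite !divr_gt0 //; exact: (Ht i).1.
move=> y [k [w [c [Fw c1 yE]]]] He.
have yv : y - x \in <<v>>%VS.
  apply: rpredB; last exact: Fv.
  by rewrite yE; apply: memv_suml => i _; apply: memvZ; exact: Fv.
pose d (i : 'I_m) := coord X i (y - x).
have dE : y - x = \sum_i d i *: X`_i by exact: coord_span.
have dB i : `|d i| * m.+1%:R <= t i.
  have : `|d i| <= e * B i.
    rewrite /d [in leLHS](coord_vbasis (memvf (y - x))) linear_sum /=.
    apply: le_trans (ler_norm_sum _ _ _) _.
    apply: (@le_trans _ _ (\sum_(k < \dim (fullv : {vspace V})) e * `|coord X i E`_k|)).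
      apply: ler_sum => l _; rewrite linearZ /= normrM ler_wpM2r //.
      exact/ltW/He.
    rewrite -mulr_sumr ler_wpM2l //; last by rewrite /B lerDr ler01.
    by rewrite /e le_bigmin ?ler01 // => l _; rewrite !divr_ge0 // ?(ltW (B0 _)) // ltW // (Ht l).1.
  have : e <= t i / m.+1%:R / B i by exact: bigmin_le.
  rewrite ler_pdivlMr // ler_pdivlMr // => H1 H2.
  by apply: le_trans H1; rewrite ler_wpM2r.
have Fd i : F (x + (m.+1%:R * d i) *: X`_i).
  have [t0 Ft] := Ht i; have := dB i; rewrite -[m.+1%:R in X in X -> _]gtr0_norm // -normrM mulrC => H.
  have [s0|s0] := leP 0 (m.+1%:R * d i).
    by apply: cF.1 => //; exact: convex_coneZ.
  rewrite ltr0_norm // in H; set s := m.+1%:R * d i in s0 H *.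
  have -> : x + s *: X`_i = (1 + s / t i) *: x + (- s / t i) *: (x - t i *: X`_i).
    rewrite scalerBr scalerA mulNr mulNr divfK ?gt_eqF // scalerDl scale1r scaleNr.
    by rewrite -addrA; congr (_ + _); rewrite addrA subrr add0r scaleNr opprK.
  apply: cF.1; apply: convex_coneZ => //; last by rewrite divr_ge0 // ?oppr_ge0 ltW.
  by rewrite -[1](@divff _ (t i)) ?gt_eqF // -mulrDl divr_ge0 ?(ltW t0) //; lra.
(* The mean of [m.+1] points: [x] itself and, for each spanning vector, [x] displaced by [m.+1]
   times the coordinate of [y - x]. *)
have -> : y = m.+1%:R^-1 *: x + \sum_i m.+1%:R^-1 *: (x + (m.+1%:R * d i) *: X`_i).
  rewrite (eq_bigr (fun i => m.+1%:R^-1 *: x + d i *: X`_i)); last first.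
    by move=> i _; rewrite scalerDr scalerA mulKf ?gt_eqF.
  rewrite big_split /= sumr_const card_ord addrA -dE.
  by rewrite -mulrS -scaler_nat scalerA divff ?gt_eqF // scale1r addrC subrK.
apply: cF.1; first by apply: convex_coneZ; rewrite // invr_ge0.
by apply: convex_cone_sum => // i _; rewrite invr_ge0.
Qed.

Lemma cone_dim_image_le (f : {linear V -> V}) S :
  (cone_dim (f @` S) <= cone_dim S)%N.
Proof.
have [v [vS fv Sv]] := spanning_seq S.
rewrite /cone_dim (lin_hullE vS Sv) (eqP fv).
apply: (@leq_trans (\dim <<map f v>>)); last by rewrite -(size_map f v) dim_span.
apply: dimvS.
apply: lin_hull_sub => _ [x /Sv xv <-].
have -> : x = \sum_(i < size v) coord (in_tuple v) i x *: (in_tuple v)`_i by exact: coord_span.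
rewrite linear_sum; apply: memv_suml => i _; rewrite linearZ_LR; apply: memvZ.
by apply: memv_span; apply: map_f; apply: (@mem_nth _ 0 v); exact: ltn_ord.
Qed.

Section Images.
Variables (f g : {linear V -> V}).
Hypotheses (fK : cancel f g) (gK : cancel g f).

Lemma image_memE S x : (f @` S) x <-> S (g x).
Proof.
split; first by move=> [y Sy <-]; rewrite fK.
by move=> Sgx; exists (g x).
Qed.

Lemma cone_dim_image S : cone_dim (f @` S) = cone_dim S.
Proof.
apply/eqP; rewrite eqn_leq cone_dim_image_le /=.
have := cone_dim_image_le g (f @` S); suff <- : S = g @` (f @` S) by [].
apply/seteqP; split=> [x Sx|x [_ [y Sy <-] <-]]; last by rewrite fK.
by exists (f x); rewrite ?fK //; exists x.
Qed.

Lemma face_image Y F : f @` Y = Y -> Fa Y F -> Fa Y (f @` F).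
Proof.
move=> fY [[[cD cZ] FY H] [x Fx]].
have Yg y : Y y -> Y (g y) by move=> Yy; apply/image_memE; rewrite fY.
split; last by exists (f x), x.
split.
- split=> [a b /image_memE Fa /image_memE Fb|c a c0 /image_memE Fa].
    by apply/image_memE; rewrite linearD; exact: cD.
  by apply/image_memE; rewrite linearZ_LR; exact: cZ.
- by rewrite -[X in _ `<=` X]fY => _ [y /FY Yy <-]; exists y.
- move=> a b [Ya nFa] Yb.
  have [] := H (g a) (g b) _ (Yg _ Yb).
    by split; [exact: Yg|move=> Fga; apply: nFa; apply/image_memE].
  rewrite -linearD => Yab nFab; split; last by move=> /image_memE.
  by rewrite -fY; apply/image_memE.
Qed.

Lemma core_image F x : core F x -> core (f @` F) (f x).
Proof.
move=> [Fx Cx]; split; first by exists x.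
move=> _ [y Fy <-]; have [t t0 Ft] := Cx y Fy; exists t => //.
by exists (x - t *: y) => //; rewrite linearB /= linearZ_LR.
Qed.

End Images.

(* Extreme rays of a finitely generated pointed cone, lifted from the quotient by
   the linear hull of [F1]: a generator in a minimal generating set modulo this
   hull spans, together with [F1], a face. *)
Lemma face_atom Y F1 F2 (T : finType) (g : T -> V) :
  convex_cone Y -> Y 0 -> Fa Y F1 -> Fa Y F2 -> F1 `<` F2 ->
  (forall k, F2 (g k)) ->
  (forall x, F2 x -> exists c : T -> R, (forall k, 0 <= c k) /\
     x - \sum_k c k *: g k \in lin_hull F1) ->
  exists F, [/\ Fa Y F, F1 `<=` F, F `<=` F2 & cone_dim F = (cone_dim F1 + 1)%N].
Proof.
move=> cY Y0 fF1 fF2 [F12 F21] F2g F2gen.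
have F10 := face0 Y0 fF1; have F20 := face0 Y0 fF2.
set W := lin_hull F1 in F2gen *.
pose P (B : {set T}) := `[< forall x, F2 x -> exists c : T -> R, (forall k, 0 <= c k) /\
  x - \sum_(k in B) c k *: g k \in W >].
have PT : P finset.setT.
  apply/asboolP => x /F2gen[c [c0 H]]; exists c; split => //.
  by rewrite (eq_bigl xpredT) // => k; rewrite inE.
have [B /minsetP[/asboolP PB minB] _] := minset_exists PT.
have drop b : b \in B -> (exists d : T -> R, (forall k, 0 <= d k) /\
    g b - \sum_(k in B :\ b) d k *: g k \in W) -> False.
  move=> bB [d [d0 Hd]].
  suff /(minB _) /(_ (finset.subsetDl _ _))/setP/(_ b) : P (B :\ b) by rewrite !inE eqxx bB.
  apply/asboolP => x /PB[c [c0 Hc]].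
  exists (fun k => c k + c b * d k); split.
    by move=> k; rewrite addr_ge0 // mulr_ge0.
  have -> : x - \sum_(k in B :\ b) (c k + c b * d k) *: g k =
     (x - \sum_(k in B) c k *: g k) + c b *: (g b - \sum_(k in B :\ b) d k *: g k).
    rewrite (eq_bigr (fun k => c k *: g k + c b *: (d k *: g k))); last first.
      by move=> k _; rewrite scalerDl scalerA.
    rewrite big_split /= -scaler_sumr [in RHS](finset.big_setD1 b) //= scalerBr.
    by rewrite !opprD [in RHS](addrA x) [in RHS](addrAC x) [in RHS]addrA subrK addrA.
  by apply: rpredD => //; apply: rpredZ.
have gW b : b \in B -> g b \notin W.
  move=> bB; apply/negP => gb; apply: (drop b bB); exists (fun=> 0); split => //.
  by rewrite big1 ?subr0 // => k _; rewrite scale0r.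
have [b bB] : exists b, b \in B.
  apply: contrapT => no; apply: F21 => x F2x.
  have [c [_ Hc]] := PB x F2x; apply: (face_lin_hull Y0 fF1 (face_sub fF2 F2x)).
  rewrite big_pred0 ?subr0 // in Hc => k.
  by apply/negP => kB; apply: no; exists k.
pose F := [set x | F2 x /\ exists2 t, 0 <= t & x - t *: g b \in W].
have F1F : F1 `<=` F.
  move=> x F1x; split; first exact: F12.
  by exists 0 => //; rewrite scale0r subr0 mem_lin_hull.
have Fb : F (g b).
  by split=> //; exists 1 => //; rewrite scale1r subrr mem0v.
(* Extremality of [g b] modulo [W]. If [e b < t], then [g b] is a nonnegative combination of the
   other generators modulo [W], against minimality. Otherwise the remainder lies in [F1], and all
   its coefficients vanish because no generator in [B] lies in [W]. *)
have addF x y : F2 x -> F2 y -> F (x + y) -> F x.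
  move=> F2x F2y [_ [t t0 Ht]]; split=> //.
  have [c [c0 Hc]] := PB x F2x; have [d [d0 Hd]] := PB y F2y.
  pose e k := c k + d k; have e0 k : 0 <= e k by rewrite addr_ge0.
  have He : \sum_(k in B) e k *: g k - t *: g b \in W.
    have -> : \sum_(k in B) e k *: g k - t *: g b = (x + y - t *: g b) -
       ((x - \sum_(k in B) c k *: g k) + (y - \sum_(k in B) d k *: g k)).
      rewrite (addrACA x) -opprD opprB [RHS]addrC [RHS]addrA subrK; congr (_ - _).
      by rewrite -big_split /=; apply: eq_bigr => k _; rewrite scalerDl.
    by apply: rpredB => //; apply: rpredD.
  have [et|te] := ltP (e b) t.
    exfalso; apply: (drop b bB); exists (fun k => e k / (t - e b)); split.
      by move=> k; rewrite divr_ge0 // subr_ge0 ltW.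
    have te0 : t - e b != 0 by rewrite subr_eq0 gt_eqF.
    have -> : g b - \sum_(k in B :\ b) (e k / (t - e b)) *: g k =
       (- (t - e b)^-1) *: (\sum_(k in B) e k *: g k - t *: g b).
      rewrite [in RHS](finset.big_setD1 b) //= [in RHS]addrAC -scalerBl scalerDr scalerA.
      rewrite mulNr -mulrN opprB mulVf // scale1r; congr (_ + _).
      rewrite scaleNr scaler_sumr; congr (- _).
      by apply: eq_bigr => k _; rewrite scalerA mulrC.
    by apply: rpredZ.
  have cFa : convex_cone F2 := face_cone fF2.
  pose e' k := if k == b then e b - t else e k.
  have e'0 k : 0 <= e' k by rewrite /e'; case: eqP => // _; rewrite subr_ge0.
  have sE : \sum_(k in B) e' k *: g k = \sum_(k in B) e k *: g k - t *: g b.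
    rewrite (finset.big_setD1 b) //= [in RHS](finset.big_setD1 b) //= addrAC -scalerBl.
    rewrite /e' eqxx; congr (_ + _); apply: eq_bigr => k.
    by rewrite !inE => /andP[/negbTE ->].
  have F1s : F1 (\sum_(k in B) e' k *: g k).
    apply: (face_lin_hull Y0 fF1); last by rewrite sE.
    by apply: (face_sub fF2); apply: convex_cone_sum.
  have z k : k \in B -> e' k = 0.
    move=> kB; apply/eqP; rewrite eq_le e'0 andbT leNgt; apply/negP => ek.
    have /negP[] := gW k kB; apply: mem_lin_hull; apply: (face_scale fF1 ek).
    move: F1s; rewrite (finset.big_setD1 k) //=; apply: (face_addl fF1).
      by apply: (face_sub fF2); exact: cFa.2.
    by apply: (face_sub fF2); apply: convex_cone_sum.
  exists (c b); first exact: c0.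
  suff <- : \sum_(k in B) c k *: g k = c b *: g b by [].
  rewrite (finset.big_setD1 b) //= big1 ?addr0 // => k; rewrite !inE => /andP[kb kB].
  have := z k kB; rewrite /e' (negbTE kb) /e => ek.
  have -> : c k = 0 by apply/eqP; rewrite eq_le c0 andbT; have := d0 k; lra.
  by rewrite scale0r.
have cF : convex_cone F.
  have [cD cZ] := face_cone fF2; split=> [x y [F2x [s s0 Hs]] [F2y [t t0 Ht]]|a x a0 [F2x [t t0 Ht]]].
    split; first exact: cD.
    exists (s + t); first exact: addr_ge0.
    by rewrite scalerDl opprD addrACA; exact: rpredD.
  split; first exact: cZ.
  exists (a * t); first by rewrite mulr_ge0 // ltW.
  by rewrite -scalerA -scalerBr; exact: rpredZ.
exists F; split => //; last 1 first.
- rewrite /cone_dim -/W; have -> : lin_hull F = (W + <[g b]>)%VS.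
    apply: subv_anti; apply/andP; split.
      apply: lin_hull_sub => x [_ [t _ Ht]].
      by rewrite -[x](subrK (t *: g b)) memv_add // memvZ // memv_line.
    rewrite subv_add lin_hullS //=; apply: (subv_trans _ (subvv _)).
    by rewrite -memvE mem_lin_hull.
  rewrite dimv_disjoint_sum.
    rewrite dim_vline; suff -> : g b != 0 by [].
    by apply: contraNneq (gW b bB) => ->; exact: mem0v.
  apply/eqP; rewrite -subv0; apply/subvP => x; rewrite memv_cap memv0.
  move=> /andP[xW /vlineP[a xE]]; rewrite xE in xW *.
  have [->|a0] := eqVneq a 0; first by rewrite scale0r.
  have /negP[] := gW b bB; rewrite -[g b]scale1r -(mulVf a0) -scalerA.
  exact: memvZ.
- split; last by exists (g b).
  split=> //; first by move=> x [/(face_sub fF2)].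
  move=> x y [Yx nFx] Yy; split; first exact: cY.1.
  move=> Fxy; have [F2xy _] := Fxy; apply: nFx.
  by apply: (addF x y) Fxy; [exact: (face_addl fF2 Yx Yy)|exact: (face_addr fF2 Yx Yy)].
- by move=> x [].
Qed.

End ConvexCones.

(** * The chamber, the Tits cone and faces of invariant cones *)

Section CoxeterGeometry.
Variables (R : realType) (V : vectType R) (n : nat).
Variables (eta : 'I_n -> {scalar V}) (alpha : 'I_n -> V).
Hypothesis eta_alpha : forall i, eta i (alpha i) = 2.

Notation refl := (refl eta alpha).
Notation act := (act eta alpha).
Notation A := (cartan eta alpha).
Notation dom := (dom eta).

Definition open_ch : set V := [set x | forall i, 0 < eta i x].
Definition closed_ch : set V := [set x | forall i, 0 <= eta i x].

Hypothesis wall_pt :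
  forall j, exists q, eta j q = 0 /\ forall k, k != j -> 0 < eta k q.
Hypothesis act_disjoint :
  forall w c, open_ch c -> open_ch (act w c) -> forall x, act w x = x.
Hypothesis n_gt0 : (0 < n)%N.

Lemma open_ch_comb a b x y : open_ch x -> open_ch y -> 0 < a -> 0 <= b ->
  open_ch (a *: x + b *: y).
Proof.
move=> Cx Cy a0 b0 i; rewrite linearD /= !scalarZ.
by rewrite ltr_pwDl ?mulr_gt0 ?mulr_ge0 // ltW.
Qed.

Lemma small_perturb (P : pred 'I_n) (x y : V) :
  (forall i, P i -> 0 < eta i x) ->
  exists2 e, 0 < e & forall i, P i -> 0 < eta i (x + e *: y).
Proof.
move=> Px; pose b i : R := (eta i x) / (1 + `|eta i y|).
have b0 i : P i -> 0 < b i by move=> /Px ?; rewrite divr_gt0 // ltr_pwDl.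
exists (\big[Num.min/1]_(i | P i) (b i)) => [|i Pi].
  by elim/big_ind: _ => //= u v u0 v0; rewrite lt_min u0.
set e := \big[_/_]_(_ | _) _.
have e0 : 0 < e by rewrite /e; elim/big_ind: _ => //= u v u0 v0; rewrite lt_min u0.
have le_eb : e <= b i by rewrite /e; exact: bigmin_le_cond.
rewrite linearD /= scalarZ.
have y0 : 0 < 1 + `|eta i y| by rewrite ltr_pwDl.
have : e * (1 + `|eta i y|) <= eta i x by rewrite -ler_pdivlMr.
have := ler_norm (- eta i y); rewrite normrN.
nra.
Qed.

Lemma open_ch_nonempty : exists c, open_ch c.
Proof.
have [q [q0 qp]] := wall_pt (Ordinal n_gt0).
set j := Ordinal n_gt0 in q0 qp.
have [e e0 He] := @small_perturb (predC1 j) q (alpha j) qp.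
exists (q + e *: alpha j) => i; have [->|/He//] := eqVneq i j.
by rewrite linearD /= scalarZ q0 eta_alpha add0r mulr_gt0.
Qed.

(** The root in question is [eta i \o act w]; its being negative is the criterion for [i :: w] to be
    shortened below [w] ([exchange]). *)
Definition pos_root w i := forall c, open_ch c -> 0 < eta i (act w c).
Definition neg_root w i := forall c, open_ch c -> eta i (act w c) < 0.

(** At a zero, the conjugate of [refl i] by [w] would fix a point of the open chamber and so be the
    identity; but [refl i] does not fix [alpha i]. *)
Lemma root_neq0 w i c : open_ch c -> eta i (act w c) != 0.
Proof.
move=> Cc; apply/eqP => E.
have Ec : act (rev w ++ i :: w) c = c.
  by rewrite act_cat act_cons refl_fix ?act_revK.
have := @act_disjoint (rev w ++ i :: w) c Cc; rewrite Ec => /(_ Cc) F.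
have /(refl_fixE eta_alpha) : refl i (alpha i) = alpha i.
  have := F (act (rev w) (alpha i)).
  rewrite act_cat act_cons act_Krev // => /(congr1 (act w)).
  by rewrite !act_Krev.
by rewrite eta_alpha => /eqP; rewrite pnatr_eq0.
Qed.

Lemma root_sign w i : pos_root w i \/ neg_root w i.
Proof.
have [H|H] := pselect (pos_root w i); [by left|right] => c' Cc'.
rewrite ltNge; apply/negP => c'0; apply: H => c Cc.
rewrite ltNge; apply/negP => c0.
have {}c0 : eta i (act w c) < 0 by rewrite lt_neqAle c0 root_neq0.
have {}c'0 : 0 < eta i (act w c') by rewrite lt_neqAle c'0 eq_sym root_neq0.
pose c2 := eta i (act w c') *: c + (- eta i (act w c)) *: c'.
have C2 : open_ch c2 by apply: open_ch_comb => //; lra.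
have /eqP[] := root_neq0 w i C2.
rewrite /c2 !linearD /= !linearZ_LR /=; ring.
Qed.

Lemma pos_root_ge0 w i c : pos_root w i -> closed_ch c -> 0 <= eta i (act w c).
Proof.
move=> P Cc; rewrite leNgt; apply/negP => H.
have [c0 C0] := open_ch_nonempty.
have P0 := P _ C0.
pose a := eta i (act w c); pose b := eta i (act w c0).
have C1 : open_ch (c + (- a / b) *: c0).
  move=> k; rewrite linearD /= scalarZ ltr_wpDl ?Cc // mulr_gt0 ?C0 //.
  by rewrite divr_gt0 // oppr_gt0.
have := P _ C1; rewrite !linearD /= !linearZ_LR /= -/a -/b.
by rewrite divfK ?gt_eqF // subrr ltxx.
Qed.

Lemma neg_root_cons w i : neg_root w i -> pos_root (i :: w) i.
Proof.
by move=> N c /N; rewrite act_cons eta_refl eta_alpha => ?; lra.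
Qed.

Lemma neg_root_le0 w i c : neg_root w i -> closed_ch c -> eta i (act w c) <= 0.
Proof.
move=> /neg_root_cons P /(pos_root_ge0 P).
by rewrite act_cons eta_refl eta_alpha => ?; lra.
Qed.

(** At a point in the middle of wall [j] both signs hold, so the root is zero there. It stays
    nonnegative under small displacements inside the wall, hence vanishes on the hyperplane and is a
    multiple of [eta j]. *)
Lemma wall_root u i j : pos_root u i -> neg_root (rcons u j) i ->
  forall x, eta i (act u x) = eta i (act u (alpha j)) / 2 * eta j x.
Proof.
move=> P N.
have [q [q0 qp]] := wall_pt j.
have Cq : closed_ch q.
  by move=> k; have [->|/qp/ltW//] := eqVneq k j; rewrite q0.
have bq : eta i (act u q) = 0.
  have := pos_root_ge0 P Cq; have := neg_root_le0 N Cq.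
  by rewrite act_rcons refl_fix // => ? ?; lra.
have b0 v : eta j v = 0 -> 0 <= eta i (act u v).
  move=> v0; have [e e0 He] := @small_perturb (predC1 j) q v qp.
  have Ce : closed_ch (q + e *: v).
    move=> k; have [->|/He/ltW//] := eqVneq k j.
    by rewrite linearD /= scalarZ q0 v0 mulr0 addr0.
  have := pos_root_ge0 P Ce; rewrite !linearD /= !linearZ_LR /= bq add0r.
  by rewrite pmulr_rge0.
move=> x; have H v : eta j v = 0 -> eta i (act u v) = 0.
  move=> v0; have := b0 _ v0; have := b0 (- v).
  by rewrite !linearN /= v0 oppr0 => /(_ erefl) ? ?; lra.
have := H (x - (eta j x / 2) *: alpha j).
rewrite !linearB /= !linearZ_LR /= eta_alpha => H1.
have : eta j x - eta j x / 2 * 2 = 0 by field.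
by move=> /H1 ?; lra.
Qed.

(* The reflections [u^-1 s_i u] and [s_j] have the same mirror, and both map the
   chamber to the other side of the wall [j], so they agree. *)
Lemma exchange_rcons u i j : pos_root u i -> neg_root (rcons u j) i ->
  forall x, act (i :: rcons u j) x = act u x.
Proof.
move=> P N; have := wall_root P N; set cc := _ / 2 => W.
have [q [q0 qp]] := wall_pt j.
pose r := rev u ++ i :: rcons u j.
have rE x : act r x = refl j x - eta i (act u (refl j x)) *: act (rev u) (alpha i).
  by rewrite /r act_cat act_cons act_rcons {1}reflE linearB /= linearZ_LR /= act_revK.
have rq : act r q = q.
  by rewrite rE refl_fix // W q0 mulr0 scale0r subr0.
have ra : eta j (act r (alpha j)) = 2.
  rewrite rE linearB /= scalarZ W eta_refl eta_alpha.
  have := W (act (rev u) (alpha i)); rewrite act_Krev // eta_alpha => ?; nra.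
have [e1 e10 H1] := @small_perturb (predC1 j) q (alpha j) qp.
have [e2 e20 H2] := @small_perturb (predC1 j) q (act r (alpha j)) qp.
pose e := Num.min e1 e2.
have e0 : 0 < e by rewrite lt_min e10.
have Hs y e' : 0 < e' -> e <= e' ->
  (forall k, k != j -> 0 < eta k (q + e' *: y)) -> 0 < eta j y ->
  open_ch (q + e *: y).
  move=> e'0 ee' H y0 k; rewrite linearD /= scalarZ.
  have [->|kj] := eqVneq k j; first by rewrite q0 add0r mulr_gt0.
  have := H _ kj; rewrite linearD /= scalarZ; have := qp _ kj; nra.
have C1 : open_ch (q + e *: alpha j).
  apply: (Hs _ e1) => //; first by rewrite /e ge_min lexx.
  by rewrite eta_alpha.
have C2 : open_ch (act r (q + e *: alpha j)).
  rewrite linearD /= linearZ_LR /= rq; apply: (Hs _ e2) => //.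
    by rewrite /e ge_min lexx orbT.
  by rewrite ra.
move=> x; have := act_disjoint C1 C2 x.
by rewrite /r act_cat => /(congr1 (act u)); rewrite act_Krev.
Qed.

(** The root is positive for the empty prefix of [w] and negative for the whole word; the letter at
    which a prefix changes the sign is deleted. *)
Lemma exchange w i : neg_root w i ->
  exists w', [/\ (size w' < size w)%N, {subset w' <= w} &
    forall x, act (i :: w) x = act w' x].
Proof.
elim/last_ind: w => [|u j IH] N.
  have [c Cc] := open_ch_nonempty; have := N c Cc; rewrite /= => ?.
  by have := Cc i => ?; lra.
have [P|N'] := root_sign u i.
  exists u; split; first by rewrite size_rcons.
    by move=> k ku; rewrite mem_rcons inE ku orbT.
  exact: exchange_rcons P N.
have [w' [s' l' E]] := IH N'.
exists (rcons w' j); split; first by rewrite !size_rcons.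
  move=> k; rewrite !mem_rcons !inE => /orP[->//|/l' ->]; exact: orbT.
by move=> x; rewrite act_cons !act_rcons -E act_cons.
Qed.

Lemma lt0_neg_root w i c : closed_ch c -> eta i (act w c) < 0 -> neg_root w i.
Proof.
move=> Cc H; have [P|//] := root_sign w i.
by have := pos_root_ge0 P Cc; rewrite leNgt H.
Qed.

(** * Points of the Tits cone and stabilizers of chamber points *)

Definition in_tits (k : nat) (x : V) :=
  exists w c, [/\ (size w <= k)%N, closed_ch c & x = act w c].

(** This descent makes the process of reflecting at negative coordinates terminate. *)
Lemma in_tits_refl k x i : in_tits k x -> eta i x < 0 ->
  exists2 k', (k' < k)%N & in_tits k' (refl i x).
Proof.
move=> [w [c [sw Cc ->]]] H.
have [w' [s' _ E]] := exchange (lt0_neg_root Cc H).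
exists (size w'); first exact: leq_trans s' sw.
by exists w', c; split => //; rewrite -E act_cons.
Qed.

Lemma in_tits_act k w x : in_tits k x -> in_tits (size w + k) (act w x).
Proof.
move=> [w' [c [sw Cc ->]]]; exists (w ++ w'), c; split => //.
  by rewrite size_cat leq_add2l.
by rewrite act_cat.
Qed.

Lemma closed_ch_orbit w c : closed_ch c -> closed_ch (act w c) -> act w c = c.
Proof.
have [m] := ubnP (size w); elim: m w => // m IH [//|i w] sw Cc Cw; rewrite ltnS in sw.
have H : eta i (act w c) <= 0.
  by have := Cw i; rewrite act_cons eta_refl eta_alpha => ?; lra.
have [E|E] := eqVneq (eta i (act w c)) 0.
  by move: Cw; rewrite act_cons refl_fix // => Cw; rewrite IH.
have {E}H : eta i (act w c) < 0 by rewrite lt_neqAle E.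
have [w' [s' _ E]] := exchange (lt0_neg_root Cc H).
by rewrite E in Cw *; rewrite IH // (leq_trans s' (ltnW sw)).
Qed.

Lemma pos_root_id (J : {set 'I_n}) v : {subset v <= J} ->
  (forall i, i \in J -> pos_root v i) -> forall x, act v x = x.
Proof.
have [m] := ubnP (size v); elim: m v => // m IH [//|i w] sw vJ P; rewrite ltnS in sw.
have iJ : i \in J by apply: vJ; rewrite inE eqxx.
have N : neg_root w i.
  by move=> c /(P i iJ c); rewrite act_cons eta_refl eta_alpha => ?; lra.
have [w' [s' l' E]] := exchange N.
move=> x; rewrite E; apply: (IH w') => [||j jJ c Cc].
- exact: leq_trans s' (ltnW sw).
- by move=> k /l' kw; apply: vJ; rewrite inE kw orbT.
- by rewrite -E; exact: P.
Qed.

(** The root [eta i \o refl j] is positive at [qj], which [refl j] fixes; so it is nonnegative at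
    [qi], where it equals [- eta j qi * eta i (alpha j)]. *)
Lemma cartan_le0 i j : i != j -> eta i (alpha j) <= 0.
Proof.
move=> ij; have [qi [qi0 qip]] := wall_pt i; have [qj [qj0 qjp]] := wall_pt j.
have Cl k q : eta k q = 0 -> (forall l, l != k -> 0 < eta l q) -> closed_ch q.
  by move=> q0 qp l; have [->|/qp/ltW//] := eqVneq l k; rewrite q0.
have [P|N] := root_sign [:: j] i.
  have := pos_root_ge0 P (Cl _ _ qi0 qip).
  rewrite /= eta_refl qi0.
  have := qip j; rewrite eq_sym => /(_ ij); nra.
have := neg_root_le0 N (Cl _ _ qj0 qjp); rewrite /= eta_refl qj0.
have := qjp i ij; nra.
Qed.

(** The root of the word [[:: i; j]] at [j] is negative at [qi], hence nonpositive at [qj]; together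
    with [cartan_le0] this forces the entry to vanish. *)
Lemma cartan_eq0 i j : eta i (alpha j) = 0 -> eta j (alpha i) = 0.
Proof.
move=> a0; have [ij|ij] := eqVneq i j; first by rewrite -ij in a0 *.
have [qi [qi0 qip]] := wall_pt i; have [qj [qj0 qjp]] := wall_pt j.
have Cl k q : eta k q = 0 -> (forall l, l != k -> 0 < eta l q) -> closed_ch q.
  by move=> q0 qp l; have [->|/qp/ltW//] := eqVneq l k; rewrite q0.
have le := cartan_le0; have ji : j != i by rewrite eq_sym.
have := le j i ji; move: (qip j ji) (qjp i ij) => H1 H2.
have E x : eta j (act [:: i; j] x) = - eta j x - eta i x * eta j (alpha i).
  by rewrite /= !eta_refl a0 eta_alpha; ring.
have [P|N] := root_sign [:: i; j] j.
  have := pos_root_ge0 P (Cl _ _ qi0 qip); rewrite E qi0; lra.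
have := neg_root_le0 N (Cl _ _ qj0 qjp); rewrite E qj0; nra.
Qed.

Lemma cartan_sym0 i j : A i j = 0 -> A j i = 0.
Proof. by rewrite !mxE; exact: cartan_eq0. Qed.

Lemma cartan_diag i : A i i = 2.
Proof. by rewrite mxE. Qed.

Lemma cartan_offdiag i j : i != j -> A i j <= 0.
Proof. by rewrite mxE; exact: cartan_le0. Qed.

Definition tits (x : V) := exists k, in_tits k x.

Definition stab (x : V) : {set 'I_n} := [set i | eta i x == 0].

Lemma mem_stab i x : (i \in stab x) = (eta i x == 0).
Proof. by rewrite inE. Qed.

Lemma tits_act w x : tits x -> tits (act w x).
Proof. by move=> [k /(in_tits_act w)]; exists (size w + k)%N. Qed.

Lemma act_stab x w : {subset w <= stab x} -> act w x = x.
Proof.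
elim: w => [//|i w IH] H; rewrite act_cons IH.
  by apply: refl_fix; apply/eqP; rewrite -mem_stab H // inE eqxx.
by move=> j jw; rewrite H // inE jw orbT.
Qed.

(** [S] is an invariant of the process and [Q] records what is known of each letter that it uses. *)
Lemma dominate (J : {set 'I_n}) (Q : 'I_n -> Prop) (S : set V) k x :
  (forall j y, j \in J -> S y -> eta j y < 0 -> Q j /\ S (refl j y)) ->
  in_tits k x -> S x ->
  exists w, [/\ forall i, i \in w -> i \in J /\ Q i, S (act w x) &
                dom J (act w x)].
Proof.
move=> H; have [m] := ubnP k; elim: m k x => // m IH k x km kx Sx.
have [D|] := pselect (dom J x); first by exists [::].
move=> /existsNP[j /not_implyP[jJ /negP]]; rewrite -ltNge => jx.
have [Qj Sj] := H j x jJ Sx jx.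
have [k' k'k k'x] := in_tits_refl kx jx.
have [w [wJ Sw Dw]] := IH k' _ (leq_trans k'k km) k'x Sj.
exists (rcons w j); rewrite act_rcons; split => // i.
by rewrite mem_rcons inE => /orP[/eqP ->|/wJ].
Qed.

Lemma dominate_stab z x : tits x ->
  exists w, {subset w <= stab z} /\ dom (stab z) (act w x).
Proof.
move=> [k kx].
have [|//|w [wJ _ Dw]] := @dominate (stab z) (fun=> True) setT k x _ kx _ => //.
by exists w; split => // i /wJ[].
Qed.

(** Each reflection at a negative coordinate adds the positive multiple [- eta j y] of [alpha j]. *)
Lemma raise J k y : in_tits k y -> exists d : 'I_n -> R,
  (forall j, 0 <= d j) /\ dom J (y + \sum_(j in J) d j *: alpha j).
Proof.
have [m] := ubnP k; elim: m k y => // m IH k y km ky.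
have [D|] := pselect (dom J y).
  exists (fun=> 0); split => //; rewrite big1 ?addr0 // => j _; exact: scale0r.
move=> /existsNP[j /not_implyP[jJ /negP]]; rewrite -ltNge => jy.
have [k' k'k k'y] := in_tits_refl ky jy.
have [d [d0 Dd]] := IH k' _ (leq_trans k'k km) k'y.
exists (fun i => d i + (if i == j then - eta j y else 0)); split.
  by move=> i; have := d0 i; case: ifP => _ ?; lra.
suff -> : y + \sum_(i in J) (d i + (if i == j then - eta j y else 0)) *: alpha i =
  refl j y + \sum_(i in J) d i *: alpha i by [].
rewrite reflE -addrA; congr (_ + _).
rewrite (eq_bigr (fun i => d i *: alpha i + (if i == j then - eta j y else 0) *: alpha i)).
  rewrite big_split /= addrC; congr (_ + _).
  rewrite (bigD1 j) //= eqxx big1 ?addr0 ?scaleNr // => i /andP[_ /negbTE ->].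
  exact: scale0r.
by move=> i _; rewrite scalerDl.
Qed.

(* Raising [y] to a vector that is dominant on the stabilizer of [lam] adds a
   nonnegative combination [c] of simple roots with [A c >= eta x >= 0]; on a
   component that is not of finite type this forces [A c = 0]. *)
Lemma tits_sum_dom lam x y : dom (stab lam) x -> tits y ->
  lam = x + y -> forall i, i \in inf_part A (stab lam) -> eta i x = 0.
Proof.
move=> Dx [k ky] E i /in_inf_partP[K [cK fK iK]].
have [/fintype.subsetP KJ cnK] := componentW cK.
have [d [d0 Dd]] := raise (stab lam) ky.
have le l : l \in K -> eta l x <= \sum_(j in K) A l j * d j.
  move=> lK; rewrite -(sum_component cartan_sym0 d cK lK) -eta_sum.
  have := Dd l (KJ l lK); have := KJ l lK; rewrite mem_stab E !linearD /= => /eqP ? ?; lra.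
have z := @not_finite_type_ge0 _ _ A cartan_sym0 cartan_diag cartan_offdiag K d cnK fK (fun j _ => d0 j) _ i iK.
have := le i iK; rewrite z => [|l lK].
  by have := Dx i (KJ i iK) => ? ?; lra.
by apply: le_trans (le l lK); exact: Dx (KJ l lK).
Qed.

(** Reflecting both summands at some [j] in the stabilizer keeps their sum. Such a [j] with
    [eta j x < 0] cannot lie in the infinite part, since the claim for [refl j x] would fail at [j];
    so it is separated from that part and does not change [eta i x]. *)
Lemma tits_sum_fixed lam x y : tits x -> tits y -> lam = x + y ->
  forall i, i \in inf_part A (stab lam) -> eta i x = 0.
Proof.
move=> [k kx]; have [m] := ubnP k; elim: m k x y kx => // m IH k x y kx km ty E.
have [D|] := pselect (dom (stab lam) x); first exact: tits_sum_dom D ty E.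
move=> /existsNP[j /not_implyP[jJ /negP]]; rewrite -ltNge => jx.
have [k' k'k k'x] := in_tits_refl kx jx.
have E' : lam = refl j x + refl j y.
  by rewrite -linearD /= -E refl_fix //; apply/eqP; rewrite -mem_stab.
have F := IH k' (refl j x) (refl j y) k'x (leq_trans k'k km) (tits_act [:: j] ty) E'.
have jI : j \notin inf_part A (stab lam).
  by apply/negP => /F; rewrite eta_refl eta_alpha; clear -jx => ?; lra.
move=> i iI; have := F i iI; rewrite eta_refl.
have /in_inf_partP[K [cK fK iK]] := iI.
have [|] := component_sep cartan_sym0 (j := j) cK iK.
  rewrite inE jJ andbT; apply: contra jI => jK; apply/in_inf_partP; by exists K.
by rewrite mxE => -> _; rewrite mulr0 subr0.
Qed.

Lemma dom_perturb lam x : closed_ch lam -> dom (stab lam) x ->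
  exists2 e, 0 < e & closed_ch (lam + e *: x).
Proof.
move=> Cl Dx; have [|e e0 He] := @small_perturb (fun i => i \notin stab lam) lam x.
  by move=> i; rewrite mem_stab lt_neqAle Cl andbT eq_sym.
exists e => // i; have [iJ|/He/ltW//] := boolP (i \in stab lam).
move: (iJ); rewrite mem_stab linearD /= linearZ_LR => /eqP ->.
by rewrite add0r mulr_ge0 ?Dx // ltW.
Qed.

(** A positive root [eta k \o act w] that stayed positive along all short words in [K] would vanish
    off-component by [positive_orbit_bound], yet it takes the value 2 at [act (rev w) (alpha k)]. So
    it changes sign along a short word, and [wall_root] identifies it there. *)
Lemma root_bounded lam K : closed_ch lam -> component A (stab lam) K ->
  finite_type A K -> exists N, forall (w : seq 'I_n) k, {subset w <= stab lam} -> k \in K ->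
  exists (u : seq 'I_n) j a, [/\ (size u <= N)%N, a != 0 &
    forall x, eta k (act w x) = a * eta j (act u x)].
Proof.
move=> Cl cK fK; have [KJ cnK] := componentW cK; have [c [c0 Ac0]] := fK.
have K_sep i k : i \in stab lam :\: K -> k \in K -> A i k = 0.
  by move=> iJ kK; have [] := component_sep cartan_sym0 cK kK iJ.
have [K0 _] := andP cnK.
have [N HN] := positive_orbit_bound eta_alpha cartan_offdiag fK cnK KJ K_sep c0 Ac0 K0.
exists N => w k wJ kK.
wlog P : w wJ / pos_root w k => [IH|].
  have [|/neg_root_cons P] := root_sign w k; first exact: IH.
  have [i|u [j [a [su a0 E]]]] := IH (k :: w) _ P.
    by rewrite inE => /orP[/eqP ->|/wJ//]; exact: (fintype.subsetP KJ).
  exists u, j, (- a); split => [//||x]; first by rewrite oppr_eq0.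
  by rewrite mulNr -E act_cons eta_refl eta_alpha; ring.
have [u [uK su nP]] : exists u : seq 'I_n, [/\ {subset u <= K}, (size u <= N)%N &
    ~ pos_root (w ++ u) k].
  apply: contrapT => no.
  have H : forall x, vanish_off eta K (stab lam) x -> eta k (act w x) = 0.
    apply: (HN (eta k \o act w)) => u x uK su Dx /=.
    have P' : pos_root (w ++ u) k.
      by apply: contrapT => nP; apply: no; exists u.
    have [e e0 Ce] := dom_perturb Cl Dx.
    have := pos_root_ge0 P' Ce; rewrite linearD /= linearZ_LR /= act_stab; last first.
      by move=> i; rewrite mem_cat => /orP[/wJ//|/uK]; exact: (fintype.subsetP KJ).
    rewrite linearD /= linearZ_LR /= act_cat.
    have := fintype.subsetP KJ k kK; rewrite mem_stab => /eqP ->.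
    by rewrite add0r pmulr_rge0.
  have := H (act (rev w) (alpha k)); rewrite act_Krev // eta_alpha => /(_ _)/eqP.
  rewrite pnatr_eq0 => F; suff : false by []; apply: F; apply: vanish_off_act => //.
    by move=> i; rewrite mem_rev => /wJ.
  by move=> i iJ; have := K_sep i k iJ kK; rewrite mxE.
have [v [j [Pv Nv sv]]] : exists v j, [/\ pos_root (w ++ v) k, neg_root (rcons (w ++ v) j) k & (size v <= N)%N].
  elim/last_ind: u su nP {uK} => [|v j IH] su nP; first by rewrite cats0 in nP.
  have sv : (size v <= N)%N by rewrite size_rcons in su; exact: ltnW.
  have [Pv|nPv] := pselect (pos_root (w ++ v) k); last exact: IH.
  exists v, j; split => //; have [|//] := root_sign (rcons (w ++ v) j) k.
  by rewrite rcons_cat.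
have := wall_root Pv Nv; set a := _ / 2 => E.
have Ew x : eta k (act w x) = a * eta j (act (rev v) x).
  by rewrite -E act_cat act_Krev.
exists (rev v), j, a; split => //; first by rewrite size_rev.
have [c1 Cc1] := open_ch_nonempty; have := P c1 Cc1; rewrite Ew => H.
by apply: contraTneq H => ->; rewrite mul0r ltxx.
Qed.

Definition fin_stab lam := stab lam :\: inf_part A (stab lam).

Lemma fin_stab_bounded lam : closed_ch lam -> exists N, forall (w : seq 'I_n) k,
  {subset w <= stab lam} -> k \in fin_stab lam ->
  exists (u : seq 'I_n) j a, [/\ (size u <= N)%N, a != 0 &
    forall x, eta k (act w x) = a * eta j (act u x)].
Proof.
move=> Cl.
have /choice[f Hf] : forall k, exists N, k \in fin_stab lam -> forall w : seq 'I_n,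
    {subset w <= stab lam} -> exists (u : seq 'I_n) j a, [/\ (size u <= N)%N, a != 0 &
    forall x, eta k (act w x) = a * eta j (act u x)].
  move=> k; have [kF|] := boolP (k \in fin_stab lam); last by exists 0%N.
  move: kF; rewrite inE => /andP[kI kJ].
  have [K cK kK] := component_in A kJ.
  have fK : finite_type A K.
    by apply: contrapT => nf; case/negP: kI; apply/in_inf_partP; exists K.
  by have [N HN] := root_bounded Cl cK fK; exists N => _ w wJ; exact: HN.
exists (\max_k f k) => w k wJ kF.
have [u [j [a [su a0 E]]]] := Hf k kF w wJ.
exists u, j, a; split => //; apply: leq_trans su _; exact: leq_bigmax.
Qed.

(* A word in the finite part of a stabilizer is determined, as a transformation,
   by the signs that finitely many roots take on its chamber. *)
Lemma fin_stab_words lam : closed_ch lam -> exists ws : seq (seq 'I_n),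
  forall w : seq 'I_n, {subset w <= fin_stab lam} ->
  exists2 w', w' \in ws & forall x, act w x = act w' x.
Proof.
move=> Cl; have [N HN] := fin_stab_bounded Cl.
have FJ i : i \in fin_stab lam -> i \in stab lam by rewrite inE => /andP[].
have [c Cc] := open_ch_nonempty.
pose sg (w : seq 'I_n) : {set 'I_n * N.-bseq 'I_n} :=
  finset (fun p : 'I_n * N.-bseq 'I_n => eta p.1 (act p.2 (act w c)) < 0).
(* The default is never taken for [S = sg w], which [w] itself realizes. *)
pose rep S : seq 'I_n := xget [::] [set w : seq 'I_n | {subset w <= fin_stab lam} /\ sg w = S].
exists (map rep (enum {set 'I_n * N.-bseq 'I_n})) => w wF.
exists (rep (sg w)); first by apply: map_f; rewrite mem_enum.
have [repF sgE] : {subset rep (sg w) <= fin_stab lam} /\ sg (rep (sg w)) = sg w.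
  by rewrite /rep; case: xgetP => [x _ //|/(_ w) []].
set w' := rep _ in repF sgE *.
(* Up to the factor [a], the root [eta i \o act (rev w')] is one of the functionals recorded by
   [sg]. It is positive at [act w' c], so by equality of signs it is not negative at [act w c]. *)
have H x : act (rev w' ++ w) x = x.
  apply: (@pos_root_id (fin_stab lam)) => [i|i iF].
    by rewrite mem_cat mem_rev => /orP[/repF|/wF].
  have [//|/(_ c Cc)] := root_sign (rev w' ++ w) i.
  have [|u [j [a [su a0 E]]]] := HN (rev w') i _ iF.
    by move=> k; rewrite mem_rev => /repF/FJ.
  have := Cc i; rewrite -[in X in X -> _](act_revK eta_alpha w' c) act_cat !E => H1 H2.
  have /setP/(_ (j, Bseq su)) := sgE; rewrite !inE /=.
  have w0 := root_neq0 (u ++ w) j Cc; have w'0 := root_neq0 (u ++ w') j Cc.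
  rewrite !act_cat in w0 w'0.
  move: H1 H2 w0 w'0 a0; set p := eta j _; set q := eta j _ => H1 H2 q0 p0 a0.
  have [p_neg|p_pos] := ltP p 0; have [q_neg|q_pos] := ltP q 0 => // _.
  - by clear -H1 H2 p_neg q_neg; have [?|?] := ltP a 0; nra.
  - by clear -H1 H2 p_pos q_pos; have [?|?] := ltP a 0; nra.
by move=> x; move: (H x) => /(congr1 (act w')); rewrite act_cat act_Krev.
Qed.

(** * Faces of an invariant subcone of the Tits cone *)

Variable Y : set V.
Hypothesis Y_cone : convex_cone Y.
Hypothesis Y0 : Y 0.
Hypothesis Y_tits : forall x, Y x -> tits x.
Hypothesis Y_inv : forall w, act w @` Y = Y.

Implicit Types (F G : set V) (w : seq 'I_n).

Lemma act_imageE w F x : (act w @` F) x <-> F (act (rev w) x).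
Proof. exact: (image_memE (act_revK eta_alpha w) (act_Krev eta_alpha w)). Qed.

Lemma act_image_cat u w F : act (u ++ w) @` F = act u @` (act w @` F).
Proof.
by rewrite image_comp; apply: eq_imagel => x _; rewrite act_cat.
Qed.

Lemma act_image_revK w F : act (rev w) @` (act w @` F) = F.
Proof.
apply/seteqP; split=> x; rewrite act_imageE revK.
  by move=> [y Fy /(can_inj (act_revK eta_alpha w)) <-].
by exists x.
Qed.

Lemma act_imageS w F G : F `<=` G -> act w @` F `<=` act w @` G.
Proof. by move=> FG _ [x /FG Gx <-]; exists x. Qed.

Lemma face_act w F : Fa Y F -> Fa Y (act w @` F).
Proof. exact: (face_image (act_revK eta_alpha w) (act_Krev eta_alpha w) (Y_inv w)). Qed.

Lemma core_act w F x : core F x -> core (act w @` F) (act w x).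
Proof. exact: core_image. Qed.

Lemma cone_dim_act w F : cone_dim (act w @` F) = cone_dim F.
Proof. exact: (cone_dim_image (act_revK eta_alpha w)). Qed.

Lemma act_image_stable w F : (forall i, i \in w -> refl i @` F = F) -> act w @` F = F.
Proof.
elim: w => [|i w IH] H; first by rewrite (_ : act [::] = id) ?image_id.
rewrite (act_image_cat [:: i]) IH; first by apply: H; rewrite inE eqxx.
by move=> j jw; apply: H; rewrite inE jw orbT.
Qed.

Definition meets_ch F := Fa Y F /\ exists2 x, core F x & closed_ch x.

Definition low F : {set 'I_n} := [set i | `[< forall x, F x -> eta i x = 0 >]]%SET.

Lemma lowP F i : reflect (forall x, F x -> eta i x = 0) (i \in low F).
Proof. by rewrite inE; exact: asboolP. Qed.

Lemma lowS F G : F `<=` G -> low G \subset low F.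
Proof. by move=> FG; apply/fintype.subsetP => i /lowP H; apply/lowP => x /FG/H. Qed.

Lemma core_split F x y : Fa Y F -> core F x -> F y ->
  exists2 t, 0 < t & tits (t *: y) /\ tits (x - t *: y).
Proof.
move=> fF [Fx Cx] Fy; have [t t0 Ft] := Cx y Fy; exists t => //.
split; apply: Y_tits; apply: (face_sub fF) => //.
by have [_ cZ] := face_cone fF; exact: cZ.
Qed.

Lemma inf_stab_low F x : Fa Y F -> core F x -> inf_part A (stab x) \subset low F.
Proof.
move=> fF CF; apply/fintype.subsetP => i iI; apply/lowP => y Fy.
have [t t0 [ty txy]] := core_split fF CF Fy.
have /= := tits_sum_fixed ty txy (esym (subrKC _ _)) iI.
by rewrite linearZ_LR /= => /eqP; rewrite mulf_eq0 gt_eqF //= => /eqP.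
Qed.

Lemma inf_low F x : Fa Y F -> core F x -> inf_part A (low F) = inf_part A (stab x).
Proof.
move=> fF CF; apply/eqP; rewrite finset.eqEsubset; apply/andP; split.
  apply: (inf_partS cartan_offdiag); apply/fintype.subsetP => i /lowP H.
  by rewrite mem_stab H //; exact: core_sub CF.
rewrite -(inf_partK A (stab x)); exact: (inf_partS cartan_offdiag) (inf_stab_low fF CF).
Qed.

(* The zero of [eta i] on the segment from [x] to [y] is fixed by the reflection and
   lies in the relative interior of both faces. *)
Lemma refl_stable F x y i : Fa Y F -> core F x -> F y -> 0 <= eta i x -> eta i y < 0 ->
  refl i @` F = F.
Proof.
move=> fF CF Fy xi yi.
have Cp := core_comb (face_cone fF) (face0 Y0 fF) CF Fy (_ : 0 < - eta i y) xi.
have {}Cp : core F ((- eta i y) *: x + eta i x *: y) by apply: Cp; rewrite oppr_gt0.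
have := @core_act [:: i] _ _ Cp; rewrite /= refl_fix; last first.
  by rewrite linearD /= !linearZ_LR /=; ring.
by move=> Cp'; exact: (core_face_eq Y_cone Y0 (face_act [:: i] fF) fF Cp' Cp).
Qed.

(** Every letter is used at a point of [F] with negative coordinate, so it preserves [F] by
    [refl_stable] and lies outside [low F]; the latter keeps the word in the finite part in
    [meets_ch_atom]. *)
Lemma dominate_face (J : {set 'I_n}) F x y : Fa Y F -> core F x -> dom J x -> F y ->
  exists w, [/\ forall i, i \in w -> [/\ i \in J, refl i @` F = F & i \notin low F],
    act w @` F = F, F (act w y) & dom J (act w y)].
Proof.
move=> fF CF Dx Fy; have [k ky] := Y_tits (face_sub fF Fy).
have [|w [wJ Fw Dw]] := @dominate J (fun i => refl i @` F = F /\ i \notin low F) F k y _ ky Fy.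
  move=> j z jJ Fz zj; have E := refl_stable fF CF Fz (Dx j jJ) zj; split.
    split => //; apply/negP => /lowP/(_ z Fz) E0; by rewrite E0 ltxx in zj.
  by rewrite -E; exists z.
exists w; split => //; first by move=> i /wJ[? []].
by apply: act_image_stable => i /wJ[_ []].
Qed.

Lemma dom_setT x : dom finset.setT x <-> closed_ch x.
Proof. by split=> [H i|H i _]; [apply: H; rewrite inE|exact: H]. Qed.

(** A chamber point [y] in the core of the translate is pulled back into [F] and made dominant
    without leaving [F]. As the chamber is a fundamental domain, the result is [y] again, a common
    core point. *)
Lemma meets_ch_uniq w F : meets_ch F -> meets_ch (act w @` F) -> act w @` F = F.
Proof.
move=> [fF [x Cx Dx]] [fwF [y Cy Dy]].
have Cy' : core F (act (rev w) y).
  by rewrite -(act_image_revK w F); exact: core_act.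
have [v [_ vF Fv Dv]] := dominate_face fF Cx ((dom_setT x).2 Dx) (core_sub Cy').
have E : act v (act (rev w) y) = y.
  by have /dom_setT := Dv; rewrite -act_cat => /(closed_ch_orbit Dy).
have := core_act v Cy'; rewrite vF E => CFy.
exact: (core_face_eq Y_cone Y0 fwF fF Cy CFy).
Qed.

Lemma core_perturb G x y : Fa Y G -> core G y -> G x -> closed_ch x ->
  dom (stab x) y -> meets_ch G.
Proof.
move=> fG Cy Gx Cx Dy; have [e e0 Ce] := dom_perturb Cx Dy.
split => //; exists (x + e *: y) => //.
rewrite addrC -[x in _ + x]scale1r.
exact: core_comb (face_cone fG) (face0 Y0 fG) Cy Gx e0 ler01.
Qed.

Lemma face_core_exists F : Fa Y F -> exists x, core F x.
Proof. by move=> fF; exact: core_exists (face_cone fF) (face0 Y0 fF). Qed.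

(** After a core point [c] of [F] is moved into the chamber, its stabilizer is still free to make a
    core point of [G] dominant on it; a small push of [c] towards that point stays in the
    chamber. *)
Lemma pair_meets_ch F G : Fa Y F -> Fa Y G -> F `<=` G ->
  exists w, meets_ch (act w @` F) /\ meets_ch (act w @` G).
Proof.
move=> fF fG FG; have [x Cx] := face_core_exists fF; have [y Cy] := face_core_exists fG.
have [_ [w [c [_ Cc xE]]]] := Y_tits (face_sub fF (core_sub Cx)).
have cF : core (act (rev w) @` F) c.
  by rewrite -(act_revK eta_alpha w c) -xE; exact: core_act.
have yG := core_act (rev w) Cy.
have [v [vJ Dv]] := dominate_stab c (Y_tits (face_sub (face_act (rev w) fG) (core_sub yG))).
exists (v ++ rev w); rewrite !act_image_cat.
have cF' : core (act v @` (act (rev w) @` F)) c.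
  by have := core_act v cF; rewrite act_stab.
have fG' := face_act v (face_act (rev w) fG).
split; first by split; [exact: face_act (face_act _ fF)|exists c].
apply: core_perturb fG' (core_act v yG) _ Cc Dv.
exact: act_imageS (act_imageS FG) _ (core_sub cF').
Qed.

Variables (m : nat) (gen : 'I_m -> V).
Hypothesis Y_gen : forall k, Y (gen k).
Hypothesis Y_fg : forall x, Y x -> closed_ch x -> exists c : 'I_m -> R,
  (forall k, 0 <= c k) /\ x = \sum_k c k *: gen k.

Lemma meets_ch_atom F1 F2 : meets_ch F1 -> meets_ch F2 -> F1 `<` F2 ->
  inf_part A (low F1) = inf_part A (low F2) ->
  exists F, [/\ meets_ch F, F1 `<=` F, F `<=` F2 & cone_dim F = (cone_dim F1 + 1)%N].
Proof.
move=> [fF1 [lam Clam Dlam]] [fF2 [mu Cmu Dmu]] F12 EI.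
pose J := stab lam; have F1lam := core_sub Clam.
have F2lam : F2 lam by exact: F12.1.
(* Equality of types enters here: words that preserve [F2] and use only letters outside [low F2]
   avoid the infinite part. *)
have IJ : inf_part A J \subset low F2.
  by rewrite -(inf_low fF1 Clam) EI inf_part_sub.
have [cD cZ] := face_cone fF2; have F20 := face0 Y0 fF2.
have dominateF2 x : F2 x -> exists w, [/\ {subset w <= fin_stab lam},
    act w @` F2 = F2, F2 (act w x) & dom J (act w x)].
  move=> F2x; have [w [wJ wF Fw Dw]] := dominate_face fF2 Cmu (fun j (_ : j \in J) => Dmu j) F2x.
  exists w; split => // i /wJ[iJ _ iF]; rewrite inE iJ andbT.
  by apply: contra iF; exact: (fintype.subsetP IJ).
have finJ w : {subset w <= fin_stab lam} -> {subset w <= stab lam}.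
  by move=> H i /H; rewrite inE => /andP[].
have [ws Hws] := fin_stab_words Dlam.
(* Translates of the generators of the chamber part by finitely many words; those outside [F2] are
   replaced by 0. *)
pose g (p : seq_sub ws * 'I_m) : V :=
  if `[< F2 (act (rev (val p.1)) (gen p.2)) >] then act (rev (val p.1)) (gen p.2) else 0.
have F2g p : F2 (g p) by rewrite /g; case: asboolP.
have F2gen x : F2 x -> exists c, (forall p, 0 <= c p) /\
    x - \sum_p c p *: g p \in lin_hull F1.
  move=> /dominateF2[w [wF wF2 F2w Dw]].
  have [w' w's Ew] := Hws w wF.
  have Erev y : act (rev w) y = act (rev w') y.
    by rewrite -{1}(act_Krev eta_alpha w' y) -Ew act_revK.
  (* Only [lam + e *: act w x] is known to lie in the chamber. Expanding it and transporting back
     yields [x] up to [e^-1 *: lam], which vanishes modulo the hull of [F1]. *)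
  have [e e0 Ce] := dom_perturb Dlam Dw.
  have F2e : F2 (lam + e *: act w x) by apply: cD => //; exact: cZ.
  have [c [c0 cE]] := Y_fg (face_sub fF2 F2e) Ce.
  have F2c k : 0 < c k -> F2 (gen k).
    move=> ck; apply: (face_scale fF2 ck); move: F2e; rewrite cE (bigD1 k) //=.
    apply: (face_addl fF2); first exact: Y_cone.2.
    exact: convex_cone_sum.
  pose a := SeqSub w's.
  have ga k : 0 < c k -> g (a, k) = act (rev w) (gen k).
    move=> /F2c Fk; rewrite /g /= asboolT ?Erev //.
    by rewrite -Erev -act_imageE wF2.
  exists (fun p => if p.1 == a then c p.2 / e else 0); split.
    by move=> p; case: ifP => // _; rewrite divr_ge0 // ltW.
  suff -> : x - \sum_p (if p.1 == a then c p.2 / e else 0) *: g p = - e^-1 *: lam.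
    by apply: rpredZ; exact: mem_lin_hull.
  have -> : \sum_p (if p.1 == a then c p.2 / e else 0) *: g p =
      \sum_k e^-1 *: (c k *: act (rev w) (gen k)).
    rewrite (eq_bigr (fun p : seq_sub ws * 'I_m =>
      (if p.1 == a then c p.2 / e else 0) *: g (p.1, p.2))); last by case.
    rewrite -(pair_bigA _ (fun i k => (if i == a then c k / e else 0) *: g (i, k))) /=.
    rewrite (bigD1 a) //= [X in _ + X]big1 ?addr0 => [|i /negbTE ->]; last first.
      by rewrite big1 // => k _; rewrite scale0r.
    apply: eq_bigr => k _; rewrite eqxx.
    have := c0 k; rewrite le_eqVlt => /orP[/eqP <-|/ga ->]; first by rewrite mul0r !scale0r scaler0.
    by rewrite scalerA mulrC.
  have -> : \sum_k e^-1 *: (c k *: act (rev w) (gen k)) = e^-1 *: (lam + e *: x).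
    rewrite -scaler_sumr; congr (_ *: _).
    have := congr1 (act (rev w)) cE; rewrite linearD /= linearZ_LR /= (act_revK eta_alpha).
    rewrite linear_sum act_stab => [->|i]; last by rewrite mem_rev => /(finJ _ wF).
    by apply: eq_bigr => k _; rewrite linearZ_LR.
  by rewrite scalerDr scalerA mulVf ?gt_eqF // scale1r opprD addrCA subrr addr0 scaleNr.
have [F [fF F1F FF2 dF]] := face_atom Y_cone Y0 fF1 fF2 F12 F2g F2gen.
have [x Cx] := face_core_exists fF.
(* The face found need not meet the chamber; the word that corrects this fixes [lam], hence
   preserves [F1], and it preserves [F2]. *)
have [w [wF wF2 F2w Dw]] := dominateF2 x (FF2 _ (core_sub Cx)).
have wlam : act w lam = lam by apply: act_stab; exact: finJ.
have wF1 : act w @` F1 = F1.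
  apply: (core_face_eq Y_cone Y0 (face_act w fF1) fF1 _ Clam).
  by have := core_act w Clam; rewrite wlam.
have F1wF : F1 `<=` act w @` F by rewrite -{1}wF1; exact: act_imageS.
exists (act w @` F); split => //.
- exact: core_perturb (face_act w fF) (core_act w Cx) (F1wF _ F1lam) Dlam Dw.
- by rewrite -wF2; exact: act_imageS.
- by rewrite cone_dim_act.
Qed.

Variable Theta : {set 'I_n}.

Definition ups_at F := meets_ch F /\ inf_part A (low F) = Theta.

Definition fa_at G := exists w F, ups_at F /\ G = act w @` F.

Lemma fa_at_face G : fa_at G -> Fa Y G.
Proof. by move=> [w [F [[[fF _] _] ->]]]; exact: face_act. Qed.

Lemma fa_at_act w G : fa_at G -> fa_at (act w @` G).
Proof.
move=> [v [F [uF ->]]]; exists (w ++ v), F; by rewrite act_image_cat.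
Qed.

Lemma ups_fa_at F : ups_at F -> fa_at F.
Proof. by move=> uF; exists [::], F; rewrite (_ : act [::] = id) ?image_id. Qed.

Lemma fa_at_ups G : fa_at G -> meets_ch G -> ups_at G.
Proof.
by move=> [v [F [uF ->]]] mG; rewrite (meets_ch_uniq uF.1 mG).
Qed.

Lemma ups_between F1 F F2 : ups_at F1 -> ups_at F2 -> meets_ch F ->
  F1 `<=` F -> F `<=` F2 -> ups_at F.
Proof.
move=> [_ E1] [_ E2] mF F1F FF2; split => //; apply/eqP; rewrite finset.eqEsubset.
rewrite -{1}E1 -{1}E2 !(inf_partS cartan_offdiag) ?lowS //.
Qed.

(** Only two faces at a time are moved to the chamber. By [meets_ch_uniq] both pairs give the same
    translate of [F], whose type is thus bounded from both sides. *)
Lemma fa_at_between F1 F F2 : fa_at F1 -> fa_at F2 -> Fa Y F ->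
  F1 `<=` F -> F `<=` F2 -> fa_at F.
Proof.
move=> t1 t2 fF F1F FF2.
have [w [m1 mF]] := pair_meets_ch (fa_at_face t1) fF F1F.
have [w' [mF' m2]] := pair_meets_ch fF (fa_at_face t2) FF2.
have E : act w' @` F = act w @` F.
  rewrite -{2}(act_image_revK w' F) -act_image_cat; apply/esym.
  apply: (meets_ch_uniq (w := w ++ rev w')) => //.
  by rewrite act_image_cat act_image_revK.
have [_ E1] := fa_at_ups (fa_at_act w t1) m1.
have [_ E2] := fa_at_ups (fa_at_act w' t2) m2.
rewrite -(act_image_revK w F); apply/fa_at_act/ups_fa_at; split => //.
apply/eqP; rewrite finset.eqEsubset -{1}E1 -{1}E2 -{2}E.
by rewrite !(inf_partS cartan_offdiag) ?lowS //; exact: act_imageS.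
Qed.

Lemma fa_at_step F1 F2 : fa_at F1 -> fa_at F2 -> F1 `<` F2 ->
  exists F, [/\ Fa Y F, F1 `<=` F, F `<=` F2 & cone_dim F = (cone_dim F1 + 1)%N].
Proof.
move=> t1 t2 [F12 F21].
have [w [m1 m2]] := pair_meets_ch (fa_at_face t1) (fa_at_face t2) F12.
have [_ E1] := fa_at_ups (fa_at_act w t1) m1.
have [_ E2] := fa_at_ups (fa_at_act w t2) m2.
have wF12 : act w @` F1 `<` act w @` F2.
  split; first exact: act_imageS.
  move=> /(act_imageS (w := rev w)); by rewrite !act_image_revK.
have [F [[fF _] F1F FF2 dF]] := meets_ch_atom m1 m2 wF12 (etrans E1 (esym E2)).
exists (act (rev w) @` F); split.
- exact: face_act.
- by rewrite -[X in X `<=` _](act_image_revK w); exact: act_imageS.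
- by rewrite -[X in _ `<=` X](act_image_revK w); exact: act_imageS.
- by rewrite cone_dim_act dF cone_dim_act.
Qed.

(** * Maximal chains between faces of the same type *)

Section MaximalChain.
Variables (F1 F2 : set V) (D : set (set V)).
Hypotheses (t1 : fa_at F1) (t2 : fa_at F2) (F12 : F1 `<=` F2).
Hypothesis D_max : maximal_chain_between (Fa Y) F1 F2 D.

Lemma max_chain_mem F : Fa Y F -> F1 `<=` F -> F `<=` F2 ->
  (forall G, D G -> F `<=` G \/ G `<=` F) -> D F.
Proof.
move=> fF F1F FF2 cF; have [[DP Dtot] maxD] := D_max.
suff <- : D `|` [set F] = D by right.
apply: maxD; last by left.
split; first by move=> G [/DP//|->].
move=> G H [DG|->] [DH|->].
- exact: Dtot.
- by have [|] := cF G DG; [right|left].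
- exact: cF.
- by left.
Qed.

Lemma max_chain_first : D F1.
Proof.
apply: max_chain_mem => //; first exact: fa_at_face.
by move=> G DG; left; have [[DP _] _] := D_max; have [] := DP G DG.
Qed.

Lemma max_chain_last : D F2.
Proof.
apply: max_chain_mem => //; first exact: fa_at_face.
by move=> G DG; right; have [[DP _] _] := D_max; have [] := DP G DG.
Qed.

Lemma max_chain_fa_at : D `<=` fa_at.
Proof.
move=> F DF; have [[DP _] _] := D_max; have [fF F1F FF2] := DP F DF.
exact: fa_at_between t1 t2 fF F1F FF2.
Qed.

(** A face one dimension above [F] and inside [G] is comparable with every member of [D], so it
    belongs to [D] and must be [G]. *)
Lemma max_chain_step F G : successive D F G -> cone_dim G = (cone_dim F + 1)%N.
Proof.
move=> [DF DG [FG nGF] no].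
have [[DP Dtot] _] := D_max.
have [E [fE FE EG dE]] := fa_at_step (max_chain_fa_at DF) (max_chain_fa_at DG) (conj FG nGF).
have [GE|nGE] := pselect (G `<=` E).
  by rewrite -dE; congr cone_dim; exact/seteqP.
have nEF : ~ (E `<=` F).
  move=> EF; have EE : E = F by exact/seteqP.
  by move: dE; rewrite EE addn1 => /n_Sn.
have [] := no E _; last by [].
apply: max_chain_mem => // [||H DH].
- by apply: subset_trans FE; have [] := DP F DF.
- by apply: subset_trans EG _; have [] := DP G DG.
have [HF|FH] := Dtot H F DH DF; first by right; exact: subset_trans FE.
have [HG|GH] := Dtot H G DH DG; last by left; exact: subset_trans GH.
have [HF|nHF] := pselect (H `<=` F); first by right; exact: subset_trans FE.
have [GH|nGH] := pselect (G `<=` H); first by left; exact: subset_trans GH.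
by exfalso; apply: (no H DH).
Qed.

Lemma max_chain_dim_inj F G : D F -> D G -> cone_dim F = cone_dim G -> F = G.
Proof.
have [[DP Dtot] _] := D_max; wlog FG : F G / F `<=` G => [IH DF DG E|DF DG E].
  have [FG|GF] := Dtot F G DF DG; first exact: IH.
  by apply/esym; exact: IH.
apply/seteqP; split => //; apply: contrapT => GF.
have [fF _ _] := DP F DF; have [fG _ _] := DP G DG.
by have := cone_dim_mono Y0 fF fG (conj FG GF); rewrite E ltnn.
Qed.

Lemma max_chain_dim_surj d : (d <= cone_dim F2 - cone_dim F1)%N ->
  exists2 F, D F & cone_dim F = (cone_dim F1 + d)%N.
Proof.
have [[DP Dtot] _] := D_max.
elim: d => [|d IH] dle; first by exists F1; rewrite ?addn0 //; exact: max_chain_first.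
have [F DF dF] := IH (ltnW dle).
have [fF F1F FF2] := DP F DF.
have nF2F : ~ (F2 `<=` F).
  move=> F2F; have EF : F = F2 by exact/seteqP.
  by move: dle; rewrite -EF dF addKn ltnn.
(* The member of least dimension strictly above [F] is its successor in [D]. *)
pose P k := `[< exists G, [/\ D G, F `<` G & cone_dim G = k] >].
have Pex : exists k, P k.
  by exists (cone_dim F2); apply/asboolP; exists F2; split => //; exact: max_chain_last.
have [k /asboolP[G [DG FG dG]] kmin] := ex_minnP Pex.
exists G => //; rewrite addnS -dF -addn1; apply: max_chain_step; split => // E DE [FE EG].
have : (k <= cone_dim E)%N by apply: kmin; apply/asboolP; exists E.
have [fE _ _] := DP E DE; have [fG _ _] := DP G DG.
by rewrite -dG leqNgt (cone_dim_mono Y0 fE fG EG).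
Qed.

(** Dimension, shifted to start at 0, is a bijection from [D] to an initial segment; this proves
    finiteness of [D] as well. *)
Lemma max_chain_card : (D #= `I_(cone_dim F2 - cone_dim F1 + 1))%card.
Proof.
have [[DP Dtot] _] := D_max.
pose f F := (cone_dim F - cone_dim F1)%N.
have dle F G : F `<=` G -> (cone_dim F <= cone_dim G)%N.
  by move=> FG; exact: dimvS (lin_hullS FG).
have fE : f @` D = `I_(cone_dim F2 - cone_dim F1 + 1).
  apply/seteqP; split=> [_ [F DF <-]|d]; rewrite /mkset addn1 ltnS.
    by have [_ _ FF2] := DP F DF; rewrite leq_sub2r // dle.
  by move=> /max_chain_dim_surj[F DF dF]; exists F => //; rewrite /f dF addKn.
rewrite -fE card_eq_sym; apply: inj_card_eq => F G /set_mem DF /set_mem DG E.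
have [_ F1F _] := DP F DF; have [_ F1G _] := DP G DG.
apply: max_chain_dim_inj => //.
by rewrite -(subnK (dle _ _ F1F)) -(subnK (dle _ _ F1G)) -/(f F) E.
Qed.

End MaximalChain.

(** * Reflections that preserve faces or fix them pointwise *)

Lemma low_stable F i : i \in low F -> refl i @` F = F.
Proof.
move=> /lowP H; apply/seteqP; split=> [_ [x Fx <-]|x Fx]; first by rewrite refl_fix ?H.
by exists x => //; rewrite refl_fix ?H.
Qed.

(** As [i] moves some [x] in [F], the root [alpha i] is a multiple of [x - refl i x] and lies in the
    hull of [G]. So [refl i] preserves this hull and [Y], hence [G]. *)
Lemma stable_up F G i : Fa Y F -> Fa Y G -> F `<=` G -> refl i @` F = F ->
  i \notin low F -> refl i @` G = G.
Proof.
move=> fF fG FG sF /negP iF.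
have [x Fx xi] : exists2 x, F x & eta i x != 0.
  apply: contrapT => no; apply: iF; apply/lowP => x Fx.
  by apply/eqP; apply: contrapT => /negP xi; apply: no; exists x.
have Fsx : F (refl i x) by rewrite -sF; exists x.
have aG : alpha i \in lin_hull G.
  have E : alpha i = (eta i x)^-1 *: (x - refl i x).
    by rewrite reflE opprB addrC subrK scalerA mulVf // scale1r.
  by rewrite E memvZ // memvB // mem_lin_hull //; exact: FG.
have sG y : G y -> G (refl i y).
  move=> Gy; apply: (face_lin_hull Y0 fG).
    by rewrite -(Y_inv [:: i]); exists y => //; exact: face_sub fG _ Gy.
  by rewrite reflE memvB ?memvZ // mem_lin_hull.
apply/seteqP; split=> [_ [y Gy <-]|y Gy]; first exact: sG.
by exists (refl i y); [exact: sG|rewrite reflK].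
Qed.

(* If [eta i x != 0] then [x + refl i x] lies in the hyperplane [F] of [G], and the
   face property puts [x] itself into [F]. *)
Lemma low_up F G i : Fa Y F -> Fa Y G -> F `<=` G -> cone_dim G = (cone_dim F + 1)%N ->
  i \in low F -> refl i @` G = G -> i \in low G.
Proof.
move=> fF fG FG dG /lowP iF sG; apply/lowP => x Gx; apply: contrapT => /eqP xi.
have Gsx : G (refl i x) by rewrite -sG; exists x.
have iW f : f \in lin_hull F -> eta i f = 0.
  move=> /(lin_hull_cone (face_cone fF) (face0 Y0 fF))[a [b [Fa Fb ->]]].
  by rewrite linearB /= !iF // subr0.
have xW : x \notin lin_hull F by apply: contra xi => /iW ->.
have GE : lin_hull G = (lin_hull F + <[x]>)%VS.
  apply/esym/eqP; rewrite eqEdim subv_add lin_hullS //=.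
  rewrite -memvE mem_lin_hull //= -/(cone_dim G) dG dimv_disjoint_sum.
    by rewrite dim_vline (_ : x != 0) //; apply: contraNneq xW => ->; exact: mem0v.
  apply/eqP; rewrite -subv0; apply/subvP => y; rewrite memv_cap memv0.
  move=> /andP[yW /vlineP[a yE]]; have := iW _ yW; rewrite yE linearZ_LR /= => /eqP.
  by rewrite mulf_eq0 (negbTE xi) orbF => /eqP ->; rewrite scale0r.
have : x + refl i x \in lin_hull G by rewrite memvD ?mem_lin_hull.
rewrite GE => /memv_addP[f fW [_ /vlineP[a ->] E]].
have a0 : a = 0.
  have := congr1 (eta i) E; rewrite linearD /= eta_refl eta_alpha linearD /= scalarZ (iW f fW) add0r.
  move=> H; apply/eqP; have : a * eta i x == 0 by rewrite -H; apply/eqP; ring.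
  by rewrite mulf_eq0 (negbTE xi) orbF.
have Fp : F (x + refl i x).
  apply: (face_lin_hull Y0 fF); first by apply: Y_cone.1; exact: face_sub fG _ _.
  by rewrite E a0 scale0r addr0.
case/negP: xi; apply/eqP/iF; apply: (face_addl fF _ _ Fp); exact: face_sub fG _ _.
Qed.

(** Each step of [meets_ch_atom] gives a face that meets the chamber and has the same type, so the
    stability hypothesis covers it and [low_up] applies. *)
Lemma low_of_stable F1 F2 i : ups_at F1 -> ups_at F2 -> F1 `<=` F2 ->
  (forall F, ups_at F -> F1 `<=` F -> F `<=` F2 -> refl i @` F = F) ->
  i \in low F1 -> i \in low F2.
Proof.
have [d] := ubnP (cone_dim F2 - cone_dim F1); elim: d F1 => // d IH F1 dle u1 u2 F12 H i1.
have [F21|F21] := pselect (F2 `<=` F1).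
  by rewrite (_ : F2 = F1) //; exact/seteqP.
have [F [mF F1F FF2 dF]] := meets_ch_atom u1.1 u2.1 (conj F12 F21) (etrans u1.2 (esym u2.2)).
have uF := ups_between u1 u2 mF F1F FF2.
apply: (IH F) => //.
- have := cone_dim_mono Y0 u1.1.1 u2.1.1 (conj F12 F21).
  by rewrite dF; move: dle; rewrite addn1; lia.
- by move=> G uG FG GF2; apply: H => //; exact: subset_trans FG.
- apply: (low_up u1.1.1 mF.1 F1F dF i1); exact: H.
Qed.

End CoxeterGeometry.

(** * Linear Coxeter systems *)

Section LinearCoxeterSystem.
Variables (R : realType) (hh : vectType R) (n : nat).
Variables (H : 'I_n -> set hh) (L : 'I_n -> set 'Hom(hh, R^o)).
Hypothesis n_gt0 : (0 < n)%N.
Hypothesis HL : linear_coxeter_system H L.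
Variables (h : 'I_n -> hh) (alpha : 'I_n -> 'Hom(hh, R^o)).
Hypotheses (hH : forall i, H i (h i)) (alphaL : forall i, L i (alpha i)).
Hypothesis alpha_h : forall i, alpha i (h i) = 2%:R :> R.

Notation V := 'Hom(hh, R^o).

Definition pairing (i : 'I_n) (l : V) : R := l (h i).

Lemma pairing_is_scalar i : scalar (pairing i).
Proof. by move=> a x y; rewrite /pairing add_lfunE scale_lfunE. Qed.

HB.instance Definition _ i := GRing.isLinear.Build R V R *%R (pairing i)
  (pairing_is_scalar i).

Definition evaluation : 'I_n -> {scalar V} := fun i => pairing i.

Notation eta := evaluation.
Notation refl := (refl eta alpha).
Notation act := (act eta alpha).

Lemma pairing_alpha i : eta i (alpha i) = 2. Proof. exact: alpha_h. Qed.

Lemma ray_gen (U : vectType R) (S : set U) v : is_ray S -> S v -> v != 0 ->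
  S = [set x | exists2 t : R, 0 <= t & x = t *: v].
Proof.
move=> [v0 v00 ->] [s s0 ->]; rewrite scaler_eq0 negb_or => /andP[sn0 _].
apply/seteqP; split=> x [t t0 ->].
  by exists (t / s); [exact: divr_ge0|rewrite scalerA divfK].
by exists (t * s); [exact: mulr_ge0|rewrite scalerA].
Qed.

Lemma h_neq0 i : h i != 0.
Proof.
apply/eqP => E; have := alpha_h i; rewrite E linear0 => /esym/eqP.
by rewrite pnatr_eq0.
Qed.

Lemma alpha_neq0 i : alpha i != 0.
Proof.
apply/eqP => E; have := alpha_h i; rewrite E zero_lfunE => /esym/eqP.
by rewrite pnatr_eq0.
Qed.

Lemma H_ray i x : H i x <-> exists2 t : R, 0 <= t & x = t *: h i.
Proof. by rewrite {1}(ray_gen (lcs_rayH HL i) (hH i) (h_neq0 i)). Qed.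

Lemma L_ray i x : L i x <-> exists2 t : R, 0 <= t & x = t *: alpha i.
Proof. by rewrite {1}(ray_gen (lcs_rayL HL i) (alphaL i) (alpha_neq0 i)). Qed.

Lemma ge0_partE i l : ge0_part (H i) l <-> 0 <= eta i l.
Proof.
split=> [|l0 x /H_ray[t t0 ->]]; first by apply; exact: hH.
by rewrite linearZ /=; exact: mulr_ge0.
Qed.

Lemma eq0_partE i l : eq0_part (H i) l <-> eta i l = 0.
Proof.
split=> [|l0 x /H_ray[t t0 ->]]; first by apply; exact: hH.
by rewrite linearZ /= [l _]l0 scaler0.
Qed.

Lemma gt0_partE i l : gt0_part (H i) l <-> 0 < eta i l.
Proof.
split=> [|l0 x /H_ray[t t0 ->]]; first by apply; [exact: hH|exact: h_neq0].
rewrite scaler_eq0 negb_or => /andP[tn0 _].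
by rewrite linearZ /=; apply: mulr_gt0 => //; rewrite lt_neqAle eq_sym tn0.
Qed.

Lemma closed_chamberE : closed_chamber H = closed_ch eta.
Proof. by apply/seteqP; split=> l Cl i; apply/ge0_partE; exact: Cl. Qed.

Lemma chamberE : chamber H = open_ch eta.
Proof. by apply/seteqP; split=> l Cl i; apply/gt0_partE; exact: Cl. Qed.

(** Splitting [l] along [alpha i] determines any reflection of this kind, and [refl i] is one, so
    the default of [xget] is not reached. *)
Lemma sigmaE i l : sigma H L i l = refl i l.
Proof.
have two0 : 2 != 0 :> R by rewrite pnatr_eq0.
rewrite /sigma /reflection; case: xgetP => [s _ [sP sD]|no].
  pose a := eta i l / 2.
  have E : l = (l - a *: alpha i) + a *: alpha i by rewrite subrK.
  rewrite {1}E linearD (linearZ_LR s a (alpha i)) /= (sD (alpha i)); last by left; exact: alphaL.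
  rewrite (sP (l - a *: alpha i)); last first.
    by apply/eq0_partE; rewrite linearB /= scalarZ pairing_alpha /a divfK // subrr.
  by rewrite reflE scalerN -addrA -opprD -scalerDl /a -splitr.
case: (no (linfun (refl i))); split=> l' l'P; rewrite lfunE /=.
  by apply: refl_fix; apply/eq0_partE.
have Ra : refl i (alpha i) = - alpha i.
  by rewrite reflE pairing_alpha -[X in X - _]scale1r -scalerBl -scaleN1r; congr (_ *: _); ring.
have RL l2 : L i l2 -> refl i l2 = - l2.
  by move=> /L_ray[t _ ->]; rewrite linearZ_LR /= Ra scalerN.
by case: l'P => [/RL//|[l2 /RL E <-]]; rewrite linearN /= E.
Qed.

Lemma coxeter_group_act s : coxeter_group H L s -> exists w, forall l, s l = act w l.
Proof.
move=> /(_ [set s | exists w, forall l, s l = act w l]); apply; split; last first.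
  by move=> _ [i _ <-]; exists [:: i] => l; rewrite sigmaE.
split.
- by exists [::] => l; rewrite id_lfunE.
- move=> s1 s2 [w1 E1] [w2 E2]; exists (w1 ++ w2) => l.
  by rewrite comp_lfunE E1 E2 act_cat.
- move=> s1 [w1 E1]; exists (rev w1) => l.
  (* [s1^-1] is known to be an actual inverse only once the kernel is trivial. *)
  have K : lker s1 == 0%VS.
    by apply/lker0P => x y; rewrite !E1; exact: (can_inj (act_revK pairing_alpha w1)).
  by rewrite -{1}(act_Krev pairing_alpha w1 l) -E1 lker0_lfunK.
Qed.

Lemma act_coxeter_group w : exists2 s, coxeter_group H L s & forall l, s l = act w l.
Proof.
elim: w => [|i w [s sG E]].
  by exists \1%VF; [move=> G [[G1 _ _] _]|move=> l; rewrite id_lfunE].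
exists (sigma H L i \o s)%VF; last by move=> l; rewrite comp_lfunE sigmaE E.
move=> G [gG sigG]; have [_ GM _] := gG; apply: GM.
  by apply: sigG; exists i.
exact: sG.
Qed.

Lemma act_disjoint w c : open_ch eta c -> open_ch eta (act w c) ->
  forall x, act w x = x.
Proof.
move=> Cc Cwc x; have [s sG E] := act_coxeter_group w.
have [s1|s1] := pselect (s = \1%VF); first by rewrite -E s1 id_lfunE.
have : ([set s l | l in chamber H] `&` chamber H) (s c).
  by rewrite chamberE; split; [exists c|rewrite E].
by rewrite (lcs_chamber HL sG s1).
Qed.

Lemma closed_ch_cone : convex_cone (closed_ch eta).
Proof.
split=> [x y Cx Cy i|a x a0 Cx i]; first by rewrite linearD /= addr_ge0 ?Cx ?Cy.
by rewrite scalarZ mulr_ge0 ?Cx // ltW.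
Qed.

Lemma closed_ch0 : closed_ch eta 0.
Proof. by move=> i; rewrite linear0. Qed.

(** Otherwise [eta j] would vanish on the span of the chamber, which contains [alpha j]. *)
Lemma ch_pos j : exists2 x, closed_ch eta x & 0 < eta j x.
Proof.
apply: contrapT => no.
have z x : closed_ch eta x -> eta j x = 0.
  move=> Cx; apply/eqP; rewrite eq_le Cx andbT leNgt; apply/negP => H0.
  by apply: no; exists x.
have : alpha j \in lin_hull (closed_ch eta).
  by rewrite -closed_chamberE (lcs_span HL) memvf.
move=> /(lin_hull_cone closed_ch_cone closed_ch0)[a [b [Ca Cb E]]].
have := pairing_alpha j; rewrite E linearB /= !z // subrr => /esym/eqP.
by rewrite pnatr_eq0.
Qed.

Lemma wall_face j : let F := closed_chamber H `&` eq0_part (H j) in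
  Fa (closed_chamber H) F /\ (cone_dim F + 1)%N = \dim (fullv : {vspace V}).
Proof. by apply/(lcs_walls HL); exists j. Qed.

(** If [eta k] vanished on wall [j], which has codimension 1, it would be a positive multiple of
    [eta j], and the two walls would coincide. *)
Lemma wall_pos j k : k != j ->
  exists x, [/\ closed_ch eta x, eta j x = 0 & 0 < eta k x].
Proof.
move=> kj; apply: contrapT => no; have [fF dF] := wall_face j.
set F := _ `&` _ in fF dF.
have FE x : F x <-> closed_ch eta x /\ eta j x = 0.
  by rewrite /F closed_chamberE; split=> -[Cx /eq0_partE].
have Fk x : F x -> eta k x = 0.
  move=> /FE[Cx xj]; apply/eqP; rewrite eq_le Cx andbT leNgt; apply/negP => H0.
  by apply: no; exists x.
have F0 : F 0 by apply/FE; split; [exact: closed_ch0|rewrite linear0].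
have hullF f : f \in lin_hull F -> eta j f = 0 /\ eta k f = 0.
  move=> /(lin_hull_cone (face_cone fF) F0)[a [b [Fa Fb ->]]].
  have [_ aj] := (FE a).1 Fa; have [_ bj] := (FE b).1 Fb.
  by rewrite !linearB /= aj bj !Fk // subrr.
have two0 : 2 != 0 :> R by rewrite pnatr_eq0.
have aF : alpha j \notin lin_hull F.
  by apply/negP => /hullF[]; rewrite pairing_alpha => /eqP; rewrite (negbTE two0).
have full : (lin_hull F + <[alpha j]>)%VS = fullv.
  apply/eqP; rewrite eqEdim subvf -dF dimv_disjoint_sum.
    by rewrite dim_vline (alpha_neq0 j) /cone_dim leqnn.
  apply/eqP; rewrite -subv0; apply/subvP => y; rewrite memv_cap memv0.
  move=> /andP[yW /vlineP[a yE]]; have [] := hullF _ yW; rewrite yE scalarZ pairing_alpha => /eqP.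
  by rewrite mulf_eq0 (negbTE two0) orbF => /eqP -> _; rewrite scale0r.
pose c := eta k (alpha j) / 2.
have kE x : eta k x = c * eta j x.
  have : x \in (lin_hull F + <[alpha j]>)%VS by rewrite full memvf.
  move=> /memv_addP[f /hullF[fj fk] [_ /vlineP[a ->] ->]].
  by rewrite !linearD /= !scalarZ fj fk pairing_alpha !add0r mulrCA /c divfK // mulrC.
have c0 : 0 < c.
  have [x Cx xj] := ch_pos j; rewrite lt_neqAle eq_sym; apply/andP; split.
    apply/eqP => E; have := pairing_alpha k; rewrite kE E mul0r => /esym/eqP.
    by rewrite (negbTE two0).
  by have := Cx k; rewrite kE pmulr_lge0.
case/eqP: kj; apply: (lcs_walls_inj HL); apply/seteqP; split=> x [Cx /eq0_partE x0];
  split => //; apply/eq0_partE.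
  by move/eqP: x0; rewrite kE mulf_eq0 gt_eqF //= => /eqP.
by rewrite kE x0 mulr0.
Qed.

Lemma wall_pt j : exists q, eta j q = 0 /\ forall k, k != j -> 0 < eta k q.
Proof.
have /choice[f Hf] : forall k, exists x, closed_ch eta x /\
    (eta j x = 0 /\ (k != j -> 0 < eta k x)).
  move=> k; have [->|/wall_pos[x [Cx xj xk]]] := eqVneq k j; last by exists x.
  by exists 0; split; [exact: closed_ch0|rewrite linear0].
exists (\sum_k f k); split=> [|k kj].
  by rewrite linear_sum big1 // => k _; have [_ []] := Hf k.
rewrite linear_sum (bigD1 k) //= ltr_pwDl //; first by have [_ [_]] := Hf k; exact.
by apply: sumr_ge0 => l _; have [Cl _] := Hf l; exact: Cl.
Qed.

Lemma tits_coneE x : tits_cone H L x -> tits eta alpha x.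
Proof.
move=> [s /coxeter_group_act[w E] [l]]; rewrite closed_chamberE => Cl <-.
by exists (size w), w, l; split.
Qed.

Variable Y : set V.
Hypothesis Y_cone : convex_cone Y.
Hypothesis Y0 : Y 0.

Lemma UpsilonE F : Upsilon H Y F <-> meets_ch eta Y F.
Proof.
have CR x : Fa Y F -> (relint F x <-> core F x).
  by move=> fF; exact: core_relint (face_cone fF) (face0 Y0 fF).
rewrite /Upsilon closed_chamberE; split=> [[fF [x [/(CR _ fF) Cx Dx]]]|[fF [x Cx Dx]]].
  by split => //; exists x.
by split => //; exists x; split => //; apply/CR.
Qed.

Lemma upsilon_lowE F : upsilon_low H L F = low eta F.
Proof.
apply/setP => i; rewrite !inE; apply/asboolP/asboolP => E l /E; rewrite sigmaE.
  exact: (refl_fixE pairing_alpha).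
exact: refl_fix.
Qed.

Lemma sigma_imageE i F : sigma H L i @` F = refl i @` F.
Proof. by apply: eq_imagel => l _; exact: sigmaE. Qed.

Lemma upsilonP F i : reflect (refl i @` F = F) (i \in upsilon H L F).
Proof. by rewrite inE sigma_imageE; exact: asboolP. Qed.

Lemma Upsilon_atE Theta F : Upsilon_at H L (coxA h alpha) Y Theta F <->
  ups_at eta alpha Y Theta F.
Proof.
by rewrite /Upsilon_at /ups_at /= upsilon_lowE; split=> -[/UpsilonE].
Qed.

Lemma Fa_atE Theta F : Fa_at H L (coxA h alpha) Y Theta F <->
  fa_at eta alpha Y Theta F.
Proof.
split=> [[s [G [/coxeter_group_act[w E] /Upsilon_atE uG ->]]]|[w [G [/Upsilon_atE uG ->]]]].
  by exists w, G; split => //; apply: eq_imagel => l _; exact: E.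
have [s sG E] := act_coxeter_group w; exists s, G; split => //.
by apply: eq_imagel => l _; rewrite E.
Qed.

End LinearCoxeterSystem.

Theorem corollary4p34 (R : realType) (hh : vectType R) (n : nat)
    (n_gt0 : (0 < n)%N)
    (H : 'I_n -> set hh) (L : 'I_n -> set 'Hom(hh, R^o))
    (HL : linear_coxeter_system H L)
    (h : 'I_n -> hh) (alpha : 'I_n -> 'Hom(hh, R^o))
    (hH : forall i, H i (h i)) (alphaL : forall i, L i (alpha i))
    (alpha_h : forall i, alpha i (h i) = 2%:R :> R)
    (Y : set 'Hom(hh, R^o))
    (Y_cone : convex_cone Y) (Y0 : Y 0) (YX : Y `<=` tits_cone H L)
    (Y_inv : forall s, coxeter_group H L s -> [set s l | l in Y] = Y)
    (Y_fg : finitely_generated (Y `&` closed_chamber H))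
    (Theta : {set 'I_n})
    (Theta_special : special (coxA h alpha) Theta)
    (Theta_facial : facial h Theta) :
  (forall R1 R2 : set 'Hom(hh, R^o),
     Fa_at H L (coxA h alpha) Y Theta R1 ->
     Fa_at H L (coxA h alpha) Y Theta R2 ->
     R1 `<=` R2 ->
     forall D : set (set 'Hom(hh, R^o)),
       maximal_chain_between (Fa Y) R1 R2 D ->
       [/\ D `<=` Fa_at H L (coxA h alpha) Y Theta,
           forall F G, successive D F G -> cone_dim G = (cone_dim F + 1)%N &
           (D #= `I_(cone_dim R2 - cone_dim R1 + 1))%card]) /\
  (forall R1 R2 : set 'Hom(hh, R^o),
     Upsilon_at H L (coxA h alpha) Y Theta R1 ->
     Upsilon_at H L (coxA h alpha) Y Theta R2 ->
     R1 `<=` R2 ->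
     [disjoint upsilon_up H L R1 & upsilon_low H L R2]%bool /\
     [set` upsilon_up H L R1 :|: upsilon_low H L R2] =
     \bigcap_(F in [set F | [/\ Upsilon_at H L (coxA h alpha) Y Theta F,
                              R1 `<=` F & F `<=` R2]])
       [set` upsilon H L F]).
Proof.
have ep := pairing_alpha alpha_h.
have wp := wall_pt HL hH alpha_h.
have dj := act_disjoint HL hH alphaL alpha_h.
have Y_tits x : Y x -> tits (evaluation h) alpha x.
  by move=> /YX; exact: (tits_coneE HL hH alphaL alpha_h).
have Y_act w : [set act (evaluation h) alpha w x | x in Y] = Y.
  have [s sG E] := act_coxeter_group HL hH alphaL alpha_h w.
  by rewrite -[RHS](Y_inv s sG); apply: eq_imagel => l _; rewrite E.
have [m [v YE]] := Y_fg; rewrite (closed_chamberE HL hH alpha_h) in YE.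
have Y_gen k : Y (v k).
  suff [] : (Y `&` closed_ch (evaluation h)) (v k) by [].
  rewrite YE; exists (fun i => (i == k)%:R); split=> [i|]; first exact: ler0n.
  rewrite (bigD1 k) ?inE //= eqxx scale1r big1 ?addr0 // => i /andP[_ /negbTE ->].
  exact: scale0r.
have gen x : Y x -> closed_ch (evaluation h) x -> exists c : 'I_m -> R,
    (forall k, 0 <= c k) /\ x = \sum_k c k *: v k.
  move=> Yx Cx; have : (Y `&` closed_ch (evaluation h)) x by [].
  rewrite YE => -[c [c0 ->]]; exists c; split => //.
  by apply: eq_bigl => k; rewrite inE.
have fE F : Fa_at H L (coxA h alpha) Y Theta F <-> fa_at (evaluation h) alpha Y Theta F.
  exact: Fa_atE.
have uE F : Upsilon_at H L (coxA h alpha) Y Theta F <-> ups_at (evaluation h) alpha Y Theta F.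
  exact: Upsilon_atE.
split=> [R1 R2 /fE t1 /fE t2 R12 D Dmax|R1 R2 /uE u1 /uE u2 R12].
  split.
  - by move=> F DF; apply/fE; apply: (max_chain_fa_at ep wp dj n_gt0 Y_cone Y0 Y_tits Y_act t1 t2 Dmax).
  - exact: (max_chain_step ep wp dj n_gt0 Y_cone Y0 Y_tits Y_act Y_gen gen t1 t2 Dmax).
  - exact: (max_chain_card ep wp dj n_gt0 Y_cone Y0 Y_tits Y_act Y_gen gen t1 t2 R12 Dmax).
have lE F : upsilon_low H L F = low (evaluation h) F by exact: upsilon_lowE.
have uP F i : reflect ([set refl (evaluation h) alpha i l | l in F] = F) (i \in upsilon H L F).
  exact: upsilonP.
split.
  rewrite disjoint_subset; apply/fintype.subsetP => i; rewrite finset.in_setD !lE.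
  by move=> /andP[iR1 _]; apply: contra iR1; exact: (fintype.subsetP (lowS _ R12)).
apply/seteqP; split=> i /=.
  rewrite finset.in_setU => /orP[iR1|iR2] F [/uE uF R1F FR2]; last first.
    apply/uP; apply: low_stable; rewrite lE in iR2.
    exact: (fintype.subsetP (lowS _ FR2)) iR2.
  move: iR1; rewrite finset.in_setD lE => /andP[iR1 /uP sR1]; apply/uP.
  exact: (stable_up ep Y0 Y_act u1.1.1 uF.1.1 R1F sR1 iR1).
move=> Hi; have sH F : ups_at (evaluation h) alpha Y Theta F -> R1 `<=` F -> F `<=` R2 ->
    [set refl (evaluation h) alpha i l | l in F] = F.
  by move=> uF R1F FR2; apply/uP; apply: Hi; split => //; apply/uE.
rewrite finset.in_setU finset.in_setD !lE.
(* An index that fixes [R1] pointwise also fixes [R2] pointwise; for any other index, stability of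
   [R1] is enough. *)
have [iR1|iR1] /= := boolP (i \in low (evaluation h) R1).
  exact: (low_of_stable ep wp dj n_gt0 Y_cone Y0 Y_tits Y_act Y_gen gen u1 u2 R12 sH iR1).
by apply/orP; left; apply/uP; exact: sH.
Qed.
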